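(* Let $V$ be a vertex operator algebra with two commuting automorphisms $g_1,g_2$ of finite order, and set $g_3=g_1g_2$. For $k=1,2$ let $W^k$ be a $C_1$-cofinite generalized $g_k$-twisted $V$-module, and let $W^3$ be a generalized $g_3$-twisted $V$-module of finite composition length. Then the fusion rule $N(W^1,W^2;W^3)=\dim\mathcal{I}\binom{W^3}{W^1\ W^2}$ is finite.
   Context: Vertex operator algebras $(V,Y,\mathbf 1,\omega)$ are over $\mathbb{C}$, in the standard (Frenkel-Huang-Lepowsky) sense; $\mathbb{N}$ contains $0$. Twisted modules. Let $g$ be an automorphism of $V$ of finite order $T$, and let $V^{(g,r)}=\{v\in V\mid gv=e^{-2\pi \mathrm{i} r/T}v\}$, $0\le r\le T-1$. A weak $g$-twisted $V$-module (also called $g$-twisted $V$-module) is a vector space $W$ with a linear map $Y_W(-,x):V\to \mathrm{End}(W)[[x^{1/T},x^{-1/T}]]$, $v\mapsto Y_W(v,x)=\sum_{n\in\frac1T\mathbb{Z}}v_nx^{-n-1}$, such that: $Y_W(\mathbf 1,x)=\mathrm{id}_W$; $Y_W(u,x)w\in x^{r/T}W((x))$ for $u\in V^{(g,r)}$, $w\in W$; and for $v\in V^{(g,r)}$, $u\in V$, $$x_0^{-1}\delta\left(\tfrac{x_1-x_2}{x_0}\right)Y_W(v,x_1)Y_W(u,x_2)-x_0^{-1}\delta\left(\tfrac{x_2-x_1}{-x_0}\right)Y_W(u,x_2)Y_W(v,x_1)=x_1^{-1}\delta\left(\tfrac{x_2+x_0}{x_1}\right)\left(\tfrac{x_2+x_0}{x_1}\right)^{-r/T}Y_W(Y(v,x_0)u,x_2).$$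 Write $Y_W(\omega,x)=\sum_n L(n)x^{-n-2}$ and $W_{(\lambda)}=\{w\in W\mid (L(0)-\lambda)^kw=0\text{ for some }k\in\mathbb{N}\}$. A generalized $g$-twisted $V$-module is a weak one with $W=\bigoplus_{\lambda\in\mathbb{C}}W_{(\lambda)}$ such that for each $\lambda\in\mathbb{C}$, $W_{(\lambda+n/T)}=0$ for all sufficiently negative integers $n$. $C_1$-cofiniteness. $C_1(W)$ is the span of all $v_{-1}w$ with $v\in V^{(g,0)}$ homogeneous, $\mathrm{wt}\,v>0$, $w\in W$, together with all $v_{-1-r/T}w$ with $v\in V^{(g,r)}$ homogeneous, $r=1,\dots,T-1$, $\mathrm{wt}\,v\ge 0$, $w\in W$. $W$ is $C_1$-cofinite if $\dim W/C_1(W)<\infty$. Twisted logarithmic intertwining operators. Let $T_k$ be the order of $g_k$ ($k=1,2,3$) and $V^{(r_1,r_2)}=\{v\mid g_kv=e^{-2\pi \mathrm{i} r_k/T_k}v,\ k=1,2\}$ for $0\le r_k<T_k$. For $g_k$-twisted modules $W^k$, a twisted logarithmic intertwining operator of type $\binom{W^3}{W^1\ W^2}$ is a linear map $\mathcal{Y}(-,x):W^1\otimes W^2\to W^3[\log x]\{x\}$, $\mathcal{Y}(w^1,x)w^2=\sum_{n\in\mathbb{C}}\sum_{k\in\mathbb{N}}w^1_{n;k}w^2\,x^{-n-1}(\log x)^k$ ($\{x\}$ denotes formal series in arbitrary complex powers of $x$) such that: (i) for all $w^1,w^2$ and $h\in\mathbb{C}$, $w^1_{h+n;k}w^2=0$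 for $n\in\mathbb{N}$ sufficiently large, independently of $k$; (ii) for $v\in V^{(r_1,r_2)}$, $$x_0^{-1}\delta\left(\tfrac{x_1-x_2}{x_0}\right)\left(\tfrac{x_1-x_2}{x_0}\right)^{-r_1/T_1}Y_{W^3}(v,x_1)\mathcal{Y}(w^1,x_2)w^2-x_0^{-1}\delta\left(\tfrac{-x_2+x_1}{x_0}\right)\left(\tfrac{-x_2+x_1}{x_0}\right)^{-r_1/T_1}\mathcal{Y}(w^1,x_2)Y_{W^2}(v,x_1)w^2$$ $$=x_1^{-1}\delta\left(\tfrac{x_2+x_0}{x_1}\right)\left(\tfrac{x_2+x_0}{x_1}\right)^{-r_2/T_2}\mathcal{Y}(Y_{W^1}(v,x_0)w^1,x_2)w^2,$$ where $(-x)^\alpha$ means $e^{\pi \mathrm{i}\alpha}x^\alpha$; (iii) $\mathcal{Y}(L(-1)w^1,x)=\frac{d}{dx}\mathcal{Y}(w^1,x)$. These operators form a vector space $\mathcal{I}\binom{W^3}{W^1\ W^2}$, whose dimension $N(W^1,W^2;W^3)$ is called the fusion rule. *)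

(* Defs.v *)
(* The field of complex numbers is R[i], for R : realType. *)
From HB Require Import structures.
From mathcomp Require Import all_boot all_order all_algebra.
From mathcomp Require Import all_classical all_reals all_analysis.
From mathcomp Require Export complex.

Set Implicit Arguments.
Unset Strict Implicit.
Unset Printing Implicit Defensive.

Import Order.TTheory GRing.Theory Num.Theory.
Local Open Scope classical_set_scope.
Local Open Scope complex_scope.
Local Open Scope ring_scope.

Definition subspace (K : fieldType) (M : lmodType K) (U : set M) : Prop :=
  U 0 /\ forall (a : K) (x y : M), U x -> U y -> U (a *: x + y).

Definition lin_span (K : fieldType) (M : lmodType K) (A : set M) : set M :=
  [set x | exists n (c : 'I_n -> K) (a : 'I_n -> M),
      (forall i, A (a i)) /\ x = \sum_(i < n) c i *: a i].

(* dim (S / U) = n, for subspaces U `<=` S of M: the family b represents a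
   basis of S / U. *)
Definition has_qdim (K : fieldType) (M : lmodType K) (S U : set M) (n : nat) :
    Prop :=
  exists b : 'I_n -> M,
    [/\ forall i, S (b i),
        forall x, S x ->
          exists c : 'I_n -> K, U (x - \sum_(i < n) c i *: b i)
      & forall c : 'I_n -> K,
          U (\sum_(i < n) c i *: b i) -> forall i, c i = 0].

Definition has_dim (K : fieldType) (M : lmodType K) (S : set M) (n : nat) :
    Prop :=
  has_qdim S [set 0] n.

(* M is the (internal) direct sum of the subspaces U i. *)
Definition direct_sum (K : fieldType) (M : lmodType K) (I : eqType)
    (U : I -> set M) : Prop :=
  [/\ forall i, subspace (U i),
      forall x, exists (s : seq I) (f : I -> M),
        (forall i, U i (f i)) /\ x = \sum_(i <- s) f i
    & forall (s : seq I) (f : I -> M), uniq s -> (forall i, U i (f i)) ->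
        \sum_(i <- s) f i = 0 -> forall i, i \in s -> f i = 0].

Definition cexp (R : realType) (z : R[i]) : R[i] :=
  (expR (complex.Re z))%:C * (cos (complex.Im z) +i* sin (complex.Im z)).

(* e^{pi i z} *)
Definition epi (R : realType) (z : R[i]) : R[i] := cexp ('i * pi%:C * z).

Definition is_integer (R : realType) (z : R[i]) : Prop :=
  exists m : int, z = m%:~R.

Definition cbin (R : realType) (z : R[i]) (k : nat) : R[i] :=
  (\prod_(j < k) (z - j%:R)) / k`!%:R.

(** Formal calculus.  A series in arbitrary complex powers of x is represented
    by its modes: f : R[i] -> M stands for \sum_n f(n) x^{-n-1}; similarly
    F : R[i] -> R[i] -> M stands for \sum_(m, n) F m n x^{-m-1} y^{-n-1}.
    The next three definitions give the coefficient of
    x0^{-p-1} x1^{-q-1} x2^{-s-1} in the product of such a series with a delta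
    function, where each power of a binomial is expanded in nonnegative integral
    powers of its second term and (-x)^a = e^{pi i a} x^a.  The sums over i have
    finite support whenever they are used below, by the truncation conditions
    on the vertex and intertwining operators (a sum with infinite support
    is 0 by convention). *)

(* x0^{-1} delta((x1 - x2)/x0) ((x1 - x2)/x0)^a F(x1, x2)
   = \sum_(p in a + Z) x0^{-p-1} (x1 - x2)^p F(x1, x2) *)
Definition delta_left (R : realType) (M : lmodType R[i]) (a : R[i])
    (F : R[i] -> R[i] -> M) (p q s : R[i]) : M :=
  if `[< is_integer (p - a) >] then
    \sum_(i \in [set: nat])
      ((-1) ^+ i * cbin p i) *: F (p + q - i%:R) (s + i%:R)
  else 0.

(* x0^{-1} delta((-x2 + x1)/x0) ((-x2 + x1)/x0)^a F(x1, x2)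
   = \sum_(p in a + Z) x0^{-p-1} (-x2 + x1)^p F(x1, x2);
   for a = 0 the prefactor is also x0^{-1} delta((x2 - x1)/(-x0)) *)
Definition delta_right (R : realType) (M : lmodType R[i]) (a : R[i])
    (F : R[i] -> R[i] -> M) (p q s : R[i]) : M :=
  if `[< is_integer (p - a) >] then
    \sum_(i \in [set: nat])
      (epi (p - i%:R) * cbin p i) *: F (q + i%:R) (p + s - i%:R)
  else 0.

(* x1^{-1} delta((x2 + x0)/x1) ((x2 + x0)/x1)^a G(x0, x2)
   = \sum_(q in a + Z) x1^{-q-1} (x2 + x0)^q G(x0, x2) *)
Definition delta_iter (R : realType) (M : lmodType R[i]) (a : R[i])
    (G : R[i] -> R[i] -> M) (p q s : R[i]) : M :=
  if `[< is_integer (q - a) >] then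
    \sum_(i \in [set: nat])
      cbin q i *: G (p + i%:R) (q + s - i%:R)
  else 0.

(** voaY v n u is v_n u, where Y(v, x)u = \sum_n v_n u x^{-n-1}; the modes are
    indexed by R[i] and vanish outside Z. *)
Record voa (R : realType) := Voa {
  voa_sort :> lmodType R[i];
  voaY : voa_sort -> R[i] -> voa_sort -> voa_sort;
  vacuum : voa_sort;
  conformal : voa_sort;
  voa_rank : R[i];
  voa_gr : int -> set voa_sort;
  voaL := fun (n : int) (v : voa_sort) => voaY conformal (n%:~R + 1) v;
  voa_direct_sum : direct_sum voa_gr;
  voa_gr_findim : forall n, exists d, has_dim (voa_gr n) d;
  voa_gr_bounded : exists N : int, forall n, n <= N ->
    forall v, voa_gr n v -> v = 0;
  voa_linearl : forall n u, linear (fun v => voaY v n u);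
  voa_linearr : forall v n, linear (voaY v n);
  voa_modes : forall v n u, ~ is_integer n -> voaY v n u = 0;
  voa_truncation : forall u v, exists N : int, forall n : int, N <= n ->
    voaY u n%:~R v = 0;
  voa_vacuum_gr : voa_gr 0 vacuum;
  voa_conformal_gr : voa_gr 2%:Z conformal;
  voa_vacuum : forall n v, voaY vacuum n v = if n == -1 then v else 0;
  voa_creation : forall v, voaY v (-1) vacuum = v;
  voa_creation_regular : forall v (n : nat), voaY v n%:R vacuum = 0;
  voa_jacobi : forall u v w p q s,
    delta_left 0 (fun m n => voaY u m (voaY v n w)) p q s
      - delta_right 0 (fun m n => voaY v n (voaY u m w)) p q s
    = delta_iter 0 (fun m n => voaY (voaY u m v) n w) p q s;
  voa_virasoro : forall (m n : int) v,
    voaL m (voaL n v) - voaL n (voaL m v)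
    = (m - n)%:~R *: voaL (m + n) v
      + (if m + n == 0 then ((m ^+ 3 - m)%:~R / 12%:R * voa_rank) *: v else 0);
  voa_L0 : forall (n : int) v, voa_gr n v -> voaL 0 v = n%:~R *: v;
  (* Y(L(-1)v, x) = d/dx Y(v, x) *)
  voa_derivative : forall v n u,
    voaY (voaL (-1) v) n u = - n *: voaY v (n - 1) u
}.

Record voa_automorphism (R : realType) (V : voa R) (g : V -> V) : Prop := {
  aut_linear : linear g;
  aut_bijective : bijective g;
  aut_vacuum : g (vacuum V) = vacuum V;
  aut_conformal : g (conformal V) = conformal V;
  aut_Y : forall v n u, g (voaY v n u) = voaY (g v) n (g u)
}.

Definition has_order (A : Type) (g : A -> A) (T : nat) : Prop :=
  [/\ (0 < T)%N, forall x, iter T g x = x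
    & forall k, (0 < k < T)%N -> ~ (forall x, iter k g x = x)].

(* V^{(g,r)} *)
Definition eigen_gr (R : realType) (V : voa R) (g : V -> V) (T r : nat) :
    set V :=
  [set v | g v = epi (- 2%:R * (r%:R / T%:R)) *: v].

(** Weak g-twisted modules; T stands for the order of g, and twY v n w for
    v_n w. *)
Record twisted_module (R : realType) (V : voa R) (g : V -> V) (T : nat) :=
    TwistedModule {
  tw_sort :> lmodType R[i];
  twY : V -> R[i] -> tw_sort -> tw_sort;
  tw_linearl : forall n w, linear (fun v => twY v n w);
  tw_linearr : forall v n, linear (twY v n);
  tw_modes : forall v n w, ~ is_integer (T%:R * n) -> twY v n w = 0;
  tw_vacuum : forall n w, twY (vacuum V) n w = if n == -1 then w else 0;
  (* Y_W(u, x)w lies in x^{r/T} W((x)) *)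
  tw_modes_eigen : forall r u n w, (r < T)%N -> eigen_gr g T r u ->
    ~ is_integer (n + r%:R / T%:R) -> twY u n w = 0;
  tw_truncation : forall r u w, (r < T)%N -> eigen_gr g T r u ->
    exists N : int, forall m : int, N <= m ->
      twY u (m%:~R - r%:R / T%:R) w = 0;
  tw_jacobi : forall r v u w p q s, (r < T)%N -> eigen_gr g T r v ->
    delta_left 0 (fun m n => twY v m (twY u n w)) p q s
      - delta_right 0 (fun m n => twY u n (twY v m w)) p q s
    = delta_iter (- (r%:R / T%:R)) (fun m n => twY (voaY v m u) n w) p q s
}.

Section TwistedModules.
Context (R : realType) (V : voa R) (g : V -> V) (T : nat).

(* L(n) *)
Definition twL (W : twisted_module g T) (n : int) (w : W) : W :=
  twY (conformal V) (n%:~R + 1) w.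

(* W_(lambda) *)
Definition gen_weight_space (W : twisted_module g T) (lambda : R[i]) : set W :=
  [set w | exists k : nat, iter k (fun x => twL 0 x - lambda *: x) w = 0].

Definition generalized (W : twisted_module g T) : Prop :=
  direct_sum (@gen_weight_space W) /\
  forall lambda : R[i], exists N : int, forall n : int, n <= N ->
    forall w, gen_weight_space (lambda + n%:~R / T%:R) w -> w = 0 :> W.

Definition C1 (W : twisted_module g T) : set W :=
  lin_span
    ([set x | exists (v : V) (w : W) (n : int),
        [/\ eigen_gr g T 0 v, voa_gr n v, 0 < n & x = twY v (-1) w]]
     `|` [set x | exists (r : nat) (v : V) (w : W) (n : int),
        [/\ (0 < r < T)%N, eigen_gr g T r v, voa_gr n v, 0 <= n
          & x = twY v (- 1 - r%:R / T%:R) w]]).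

Definition C1_cofinite (W : twisted_module g T) : Prop :=
  exists n, has_qdim [set: W] (@C1 W) n.

Definition submodule (W : twisted_module g T) (U : set W) : Prop :=
  subspace U /\ forall v n w, U w -> U (twY v n w).

(* M is a composition series 0 = M 0 < M 1 < ... < M l = W: every quotient
   M (i + 1) / M i is simple, i.e. nonzero and without proper nonzero
   submodules. *)
Definition finite_length (W : twisted_module g T) : Prop :=
  exists (l : nat) (M : nat -> set W),
    [/\ M 0%N = [set 0], M l = [set: W],
        forall i, (i <= l)%N -> submodule (M i)
      & forall i, (i < l)%N ->
          [/\ M i `<=` M i.+1, M i <> M i.+1
            & forall U : set W, submodule U ->
                M i `<=` U -> U `<=` M i.+1 -> U = M i \/ U = M i.+1]].

End TwistedModules.

(** Twisted logarithmic intertwining operators: I w1 w2 n k is w1_{n;k} w2,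
    where I(w1, x)w2 = \sum_(n, k) w1_{n;k} w2 x^{-n-1} (log x)^k. *)
Record intertwining (R : realType) (V : voa R) (g1 g2 g3 : V -> V)
    (T1 T2 T3 : nat) (W1 : twisted_module g1 T1) (W2 : twisted_module g2 T2)
    (W3 : twisted_module g3 T3) (I : W1 -> W2 -> R[i] -> nat -> W3) : Prop := {
  int_linearl : forall w2 n k, linear (fun w1 => I w1 w2 n k);
  int_linearr : forall w1 n k, linear (fun w2 => I w1 w2 n k);
  (* each coefficient of a power of x is a polynomial in log x *)
  int_log : forall w1 w2 n, exists K : nat, forall k, (K <= k)%N ->
    I w1 w2 n k = 0;
  int_truncation : forall w1 w2 (h : R[i]), exists N : nat,
    forall n k : nat, (N <= n)%N -> I w1 w2 (h + n%:R) k = 0;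
  int_jacobi : forall r1 r2 v w1 w2 p q s k, (r1 < T1)%N -> (r2 < T2)%N ->
    eigen_gr g1 T1 r1 v -> eigen_gr g2 T2 r2 v ->
    delta_left (- (r1%:R / T1%:R))
        (fun m n => twY v m (I w1 w2 n k)) p q s
      - delta_right (- (r1%:R / T1%:R))
        (fun m n => I w1 (twY v m w2) n k) p q s
    = delta_iter (- (r2%:R / T2%:R))
        (fun m n => I (twY v m w1) w2 n k) p q s;
  (* I(L(-1)w1, x) = d/dx I(w1, x) *)
  int_derivative : forall w1 w2 n k,
    I (twL (-1) w1) w2 n k
    = - n *: I w1 w2 (n - 1) k + k.+1%:R *: I w1 w2 (n - 1) k.+1
}.

(* N(W1, W2; W3) = N; the vector space structure is the pointwise one. *)
Definition fusion_rule (R : realType) (V : voa R) (g1 g2 g3 : V -> V)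
    (T1 T2 T3 : nat) (W1 : twisted_module g1 T1) (W2 : twisted_module g2 T2)
    (W3 : twisted_module g3 T3) (N : nat) : Prop :=
  has_dim [set I : W1 -> W2 -> R[i] -> nat -> W3 | intertwining I] N.

(* Main.v *)
(* Proof idea. Filter W3 by a composition series. For a composition factor
   N / M let lam be minimal in its coset modulo Z / T3 among the weights of
   vectors of N outside M, and let H be a hyperplane of W3 containing M and
   every generalized weight space of weight other than lam, but missing some u
   of weight lam in N. If an operator I has values in N, all modes of positive
   weight send these values into H. So the Jacobi identity rewrites, modulo H,
   I(v_{-1-r1/T1} w1, x) w2 and I(w1, x) v_{-1-r2/T2} w2 in terms of values of I
   at pairs of smaller total weight, and by C_1-cofiniteness the log-free part of
   I modulo H is determined by finitely many scalars. The L(-1)-derivative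
   property then determines the coefficients of all powers of log x. If they all
   vanish, M plus the span of the values of I is a submodule of N missing u,
   hence equal to M by simplicity. Thus the operators with values in M have
   finite codimension among those with values in N. *)

Require Import Defs.
From mathcomp Require Import all_boot all_order all_algebra.
From mathcomp Require Import all_classical all_reals all_analysis.
From mathcomp Require Import ring lra zify.

(* all_analysis defines another notion named subspace. *)
Import Defs.

Set Implicit Arguments.
Unset Strict Implicit.
Unset Printing Implicit Defensive.

Import Order.TTheory GRing.Theory Num.Theory.
Local Open Scope classical_set_scope.
Local Open Scope complex_scope.
Local Open Scope ring_scope.

(** * Subspaces *)

Section LinearFunctions.
Context (K : fieldType) (M N : lmodType K) (f : M -> N) (lf : linear f).

Lemma lin0 : f 0 = 0.
Proof. by apply: (addrI (f 0)); rewrite -{1}[f 0]scale1r -lf scale1r !addr0. Qed.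

Lemma linD x y : f (x + y) = f x + f y.
Proof. by have := lf 1 x y; rewrite !scale1r. Qed.

Lemma linZ a x : f (a *: x) = a *: f x.
Proof. by have := lf a x 0; rewrite lin0 !addr0. Qed.

Lemma linB x y : f (x - y) = f x - f y.
Proof. by rewrite -scaleN1r linD linZ scaleN1r. Qed.

Lemma lin_sum (I : Type) (s : seq I) (P : pred I) (F : I -> M) :
  f (\sum_(i <- s | P i) F i) = \sum_(i <- s | P i) f (F i).
Proof. exact: (big_morph f linD lin0). Qed.

Lemma linear_preim (U : set N) : subspace U -> subspace (f @^-1` U).
Proof.
move=> [U0 UP]; split=> [|a x y Ux Uy]; first by rewrite /preimage /= lin0.
by rewrite /preimage /= lf; exact: UP.
Qed.

End LinearFunctions.


Section Subspaces.
Context (K : fieldType) (M : lmodType K).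
Implicit Types (U S A B H : set M).

Lemma subspace0 U : subspace U -> U 0.
Proof. by move=> []. Qed.

Lemma subspaceD U x y : subspace U -> U x -> U y -> U (x + y).
Proof. by move=> [_ UP] Ux Uy; rewrite -[x]scale1r; exact: UP. Qed.

Lemma subspaceZ U a x : subspace U -> U x -> U (a *: x).
Proof. by move=> [U0 UP] Ux; rewrite -[_ *: _]addr0; exact: UP. Qed.

Lemma subspaceB U x y : subspace U -> U x -> U y -> U (x - y).
Proof.
by move=> sU Ux Uy; rewrite -scaleN1r; apply: subspaceD => //; exact: subspaceZ.
Qed.

Lemma subspaceZr U a x : subspace U -> a != 0 -> U (a *: x) -> U x.
Proof.
by move=> sU a0 Uax; rewrite -[x](scalerK a0); exact: subspaceZ.
Qed.

Lemma subspace_sum U (I : eqType) (s : seq I) (P : pred I) (F : I -> M) :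
  subspace U -> (forall i, i \in s -> P i -> U (F i)) ->
  U (\sum_(i <- s | P i) F i).
Proof.
move=> sU UF; rewrite big_seq_cond.
elim/big_ind : _ => [|x y|i /andP[]]; [exact: subspace0 | exact: subspaceD |].
exact: UF.
Qed.

Lemma subspace_fsum U (F : nat -> M) :
  subspace U -> (forall i, U (F i)) -> U (\sum_(i \in [set: nat]) F i).
Proof. by move=> sU UF; apply: subspace_sum. Qed.

Lemma subspace_set1 : subspace ([set 0] : set M).
Proof. by split=> // a x y -> ->; rewrite scaler0 addr0. Qed.

Lemma subspace_setI U S : subspace U -> subspace S -> subspace (U `&` S).
Proof.
move=> [U0 UP] [S0 SP]; split=> // a x y [Ux Sx] [Uy Sy].
by split; [exact: UP | exact: SP].
Qed.

Lemma lin_span_subset A : A `<=` lin_span A.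
Proof.
move=> x Ax; exists 1%N, (fun=> 1), (fun=> x); split=> //.
by rewrite big_ord1 scale1r.
Qed.

Lemma lin_span_subspace A : subspace (lin_span A).
Proof.
split.
  by exists 0%N, (fun=> 0), (fun=> 0); split; [case | rewrite big_ord0].
move=> k x y [n [c [a [Aa ->]]]] [m [d [b [Ab ->]]]].
exists (n + m)%N,
  (fun i => match fintype.split i with inl j => k * c j | inr j => d j end),
  (fun i => match fintype.split i with inl j => a j | inr j => b j end); split.
  by move=> i; case: (fintype.split i).
rewrite big_split_ord /= scaler_sumr; congr (_ + _); apply: eq_bigr => i _.
  by rewrite (unsplitK (inl i)) scalerA.
by rewrite (unsplitK (inr i)).
Qed.

Lemma lin_span_min U A : subspace U -> A `<=` U -> lin_span A `<=` U.
Proof.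
move=> sU AU _ [n [c [a [Aa ->]]]].
by apply: subspace_sum => // i _ _; apply: subspaceZ => //; exact: AU.
Qed.

Lemma subspace_add U S : subspace U -> subspace S ->
  subspace [set x | exists u v, [/\ U u, S v & x = u + v]].
Proof.
move=> [U0 UP] [S0 SP]; split; first by exists 0, 0; rewrite addr0.
move=> k _ _ [u [v [Uu Sv ->]]] [u' [v' [Uu' Sv' ->]]].
exists (k *: u + u'), (k *: v + v'); split; [exact: UP | exact: SP |].
by rewrite scalerDr addrACA.
Qed.

(** By Zorn there is a maximal subspace [H] containing [U] and avoiding [u]. For [x] outside [H],
    maximality puts [u] into [H + K x], and since [u] is not in [H], its coefficient along [x] can
    be inverted. *)
Lemma exists_hyperplane U (u : M) : subspace U -> ~ U u ->
  exists H, [/\ subspace H, U `<=` H, ~ H u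
              & forall x, exists c : K, H (x - c *: u)].
Proof.
move=> sU Uu.
(* The subspaces considered are the unions of [U] with [X], so that the empty chain yields [U]
   itself. *)
pose P := [set X : set M | [/\ subspace (U `|` X) & ~ (U `|` X) u]].
have [F FP Ftot|A [[sA Au] Amax]] := @Zorn_bigcup M P.
  have UX X x : F X -> (U `|` X) x -> (U `|` \bigcup_(X in F) X) x.
    by move=> FX [Ux|Xx]; [left | right; exists X].
  have inX x : (U `|` \bigcup_(X in F) X) x -> U x \/ exists2 X, F X & (U `|` X) x.
    by case=> [?|[X FX Xx]]; [left | right; exists X => //; right].
  split; last by case=> // -[X FX Xu]; have [_ []] := FP _ FX; right.
  split; first by left; exact: subspace0.
  move=> a x y /inX[Ux|[X FX Xx]] /inX[Uy|[Y FY Yy]].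
  - by left; apply: subspaceD => //; exact: subspaceZ.
  - have [sY _] := FP _ FY.
    by apply: (UX Y) => //; apply: subspaceD => //; apply: subspaceZ => //; left.
  - have [sX _] := FP _ FX.
    by apply: (UX X) => //; apply: subspaceD => //; [exact: subspaceZ | left].
  have [sX _] := FP _ FX; have [sY _] := FP _ FY.
  have [XY|YX] := Ftot _ _ FX FY.
    apply: (UX Y) => //; apply: subspaceD => //; apply: subspaceZ => //.
    by case: Xx => [|/XY]; [left|right].
  apply: (UX X) => //; apply: subspaceD => //; first exact: subspaceZ.
  by case: Yy => [|/YX]; [left|right].
exists (U `|` A); split=> //.
move=> x; have [Hx|Hx] := pselect ((U `|` A) x).
  by exists 0; rewrite scale0r subr0.
(* [B] is [H + K x], strictly larger than [H]. *)
pose B := [set y | exists c, (U `|` A) (y - c *: x)].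
have sB : subspace B.
  split; first by exists 0; rewrite scale0r subr0; exact: subspace0.
  move=> a y z [c Hy] [d Hz]; exists (a * c + d).
  rewrite scalerDl opprD addrACA -scalerA -scalerBr.
  by apply: subspaceD => //; exact: subspaceZ.
have HB : U `|` A `<=` B by move=> y Hy; exists 0; rewrite scale0r subr0.
have Bx : B x by exists 1; rewrite scale1r subrr; exact: subspace0.
have UB : U `|` B = B by rewrite setUidPr // => y Uy; apply: HB; left.
have [[c Hux]|Bu] := pselect (B u); last first.
  exfalso; apply: (Amax B); last by split; rewrite UB.
  split; first by move=> y Ay; apply: HB; right.
  by move=> BA; apply: Hx; right; exact: BA.
have c0 : c != 0.
  by apply/eqP => c0; apply: Au; move: Hux; rewrite c0 scale0r subr0.
exists c^-1; apply: (subspaceZr (a := - c)) => //; first by rewrite oppr_eq0.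
by rewrite scalerBr scalerA mulNr divff // scaleN1r opprK scaleNr addrC.
Qed.

End Subspaces.

(** * Finite spanning families and hyperplane conditions *)

Section FiniteSpan.
Context (K : fieldType) (M : lmodType K).
Implicit Types (S : set M).

Definition finspan S := exists n (b : 'I_n -> M),
  (forall i, S (b i)) /\
  forall x, S x -> exists c : 'I_n -> K, x = \sum_(i < n) c i *: b i.

(** A spanning family of minimal length is independent: a relation with a nonzero coefficient at [i]
    would allow the vector [b i] to be dropped. *)
Lemma finspan_dim S : subspace S -> finspan S -> exists n, has_dim S n.
Proof.
move=> sS fS; have [n] := ex_minnP (P := fun n => `[< exists b : 'I_n -> M,
  (forall i, S (b i)) /\
  forall x, S x -> exists c : 'I_n -> K, x = \sum_(i < n) c i *: b i >])
  (let: ex_intro n h := fS in ex_intro _ n (asboolT h)).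
move=> /asboolP[b [Sb gb]] nmin; exists n, b; split=> // [x Sx|c c0 i].
  by have [c ->] := gb x Sx; exists c; rewrite /= subrr.
apply/eqP/negP => /negP ci0.
case: n => [|n] in b Sb gb nmin c c0 i ci0 *; first by case: i ci0.
suff : (n.+1 <= n)%N by rewrite ltnn.
apply: nmin; apply/asboolP; exists (fun j => b (lift i j)); split=> // x Sx.
(* Subtracting [d i / c i] times the relation makes the coefficient of [b i] vanish. *)
have [d ->] := gb x Sx; exists (fun j => d (lift i j) - d i / c i * c (lift i j)).
have -> : \sum_(j < n.+1) d j *: b j
    = \sum_(j < n.+1) (d j - d i / c i * c j) *: b j.
  under [RHS]eq_bigr do rewrite scalerBl -scalerA.
  by rewrite sumrB -scaler_sumr c0 scaler0 subr0.
by rewrite (bigD1_ord i) //= mulfVK // subrr scale0r add0r.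
Qed.

(** One condition [H (phi x)] cuts out a subspace of codimension at most one: a single [x0] of [S]
    violating it, added to the family [b], spans [S]. *)
Lemma finspan_hyperplane (N : lmodType K) S (phi : M -> N) (H : set N) (u : N) :
  subspace S -> linear phi -> subspace H ->
  (forall x, exists c, H (x - c *: u)) ->
  finspan [set x | S x /\ H (phi x)] -> finspan S.
Proof.
move=> sS lphi sH Hu [n [b [Sb gb]]].
have phiD a x y : phi (a *: x + y) = a *: phi x + phi y by exact: lphi.
have [allH|/existsNP[x0 /not_implyP[Sx0 Hx0]]] :=
    pselect (forall x, S x -> H (phi x)).
  exists n, b; split=> [i|x Sx]; first by have [] := Sb i.
  by apply: gb; split=> //; exact: allH.
have [c0 Hc0] := Hu (phi x0).
have c00 : c0 != 0.
  by apply/eqP => c00; move: Hc0; rewrite c00 scale0r subr0.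
exists n.+1, (fun i => if unlift ord0 i is Some j then b j else x0); split.
  by move=> i; case: unliftP => // j _; have [] := Sb j.
move=> x Sx; have [c Hc] := Hu (phi x).
have [|d dE] := gb (- (c / c0) *: x0 + x).
  split; first by apply: subspaceD => //; exact: subspaceZ.
  rewrite phiD; have -> : - (c / c0) *: phi x0 + phi x
    = (phi x - c *: u) - (c / c0) *: (phi x0 - c0 *: u).
    by rewrite scalerBr scalerA mulfVK // opprB scaleNr addrA subrK addrC.
  by apply: (subspaceB sH) => //; exact: subspaceZ.
exists (fun i => if unlift ord0 i is Some j then d j else c / c0).
rewrite big_ord_recl unlift_none.
under eq_bigr do rewrite liftK.
by rewrite -dE scaleNr addrA subrr add0r.
Qed.

Lemma finspan_hyperplanes (N : lmodType K) S (H : set N) (u : N)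
    (J : eqType) (s : seq J) (phi : J -> M -> N) :
  subspace S -> subspace H -> (forall x, exists c, H (x - c *: u)) ->
  (forall j, linear (phi j)) ->
  finspan [set x | S x /\ forall j, j \in s -> H (phi j x)] -> finspan S.
Proof.
move=> sS sH Hu lphi; elim: s => [|j s IH].
  rewrite (_ : mkset _ = S) //; apply/seteqP.
  by split=> [x []|x Sx] //=; split.
move=> fL; apply: IH; apply: (finspan_hyperplane _ (lphi j) sH Hu).
  split=> [|a x y [Sx Hx] [Sy Hy]].
    split=> [|i _]; first exact: subspace0.
    by rewrite (lin0 (lphi i)); exact: subspace0.
  split; first by apply: subspaceD => //; exact: subspaceZ.
  move=> i i_s; rewrite (lphi i a x y).
  by apply: subspaceD => //; [apply: subspaceZ => //; exact: Hx | exact: Hy].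
rewrite (_ : mkset _ = [set x | S x /\
  forall i, i \in j :: s -> H (phi i x)]) //.
apply/seteqP; split=> x /=.
  by move=> [[Sx Hs] Hj]; split=> // i /predU1P[->|/Hs].
move=> [Sx Hs]; split; last by apply: Hs; rewrite mem_head.
by split=> // i i_s; apply: Hs; rewrite inE i_s orbT.
Qed.

End FiniteSpan.

(** * Gradings *)

Lemma direct_sum_lin_span (K : fieldType) (M : lmodType K) (I : eqType)
    (U : I -> set M) x :
  direct_sum U -> lin_span [set y | exists i, U i y] x.
Proof.
move=> [_ /(_ x)[s [f [Uf ->]]] _].
apply: subspace_sum; first exact: lin_span_subspace.
by move=> i _ _; apply: lin_span_subset; exists i.
Qed.

Lemma direct_sum_uniq (K : fieldType) (M : lmodType K) (I : eqType)
    (U : I -> set M) x : direct_sum U ->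
  exists s f, [/\ uniq s, forall i, U i (f i) & x = \sum_(i <- s) f i].
Proof.
move=> [sU /(_ x)[s [f [Uf ->]]] _].
exists (undup s), (fun i => iterop (count_mem i s) +%R (f i) 0).
split; [exact: undup_uniq | move=> i | by rewrite big_undup_iterop_count].
case: (count_mem i s) => [|n]; first exact: subspace0.
by elim: n => //= n IH; exact: subspaceD.
Qed.

Lemma sum_pred1_seq (M : nmodType) (I : eqType) (s : seq I) a (F : I -> M) :
  uniq s -> a \in s -> \sum_(i <- s | i == a) F i = F a.
Proof.
by move=> us a_s; rewrite -big_filter (filter_pred1_uniq us a_s) big_seq1.
Qed.

(** Grouping an expression of [x] in homogeneous generators by degree gives the sums [F j], and by
    directness the group of degree [i] is [x] itself. *)
Lemma graded_generation (K : fieldType) (M : lmodType K) (I : eqType)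
    (U G : I -> set M) :
  direct_sum U -> (forall i, subspace (G i)) -> (forall i, G i `<=` U i) ->
  (forall x, lin_span [set y | exists i, G i y] x) ->
  forall i, U i `<=` G i.
Proof.
move=> [sU _ Uind] sG GU genG i x Ux.
have [n [c [a [Ga xE]]]] := genG x.
have [h hP] := choice Ga.
pose F j := \sum_(k < n | h k == j) c k *: a k.
have GF j : G j (F j).
  by apply: subspace_sum => // k _ /eqP <-; apply: subspaceZ.
(* The index [i] is added because possibly no generator in the expression has degree [i]. *)
pose s := undup (i :: [seq h k | k <- enum 'I_n]).
have i_s : i \in s by rewrite mem_undup mem_head.
pose f j := F j - (if j == i then x else 0).
have Uf j : U j (f j).
  apply: subspaceB => //; first exact: GU.
  by case: eqP => [->//|_]; exact: subspace0.
have fs0 : \sum_(j <- s) f j = 0.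
  rewrite sumrB -big_mkcond /= sum_pred1_seq ?undup_uniq // [X in _ - X]xE.
  apply/eqP; rewrite subr_eq0; apply/eqP; rewrite /F (exchange_big_dep predT) //=.
  apply: eq_bigr => k _; under eq_bigl do rewrite eq_sym.
  rewrite sum_pred1_seq ?undup_uniq // mem_undup inE.
  by apply/orP; right; apply: map_f; rewrite mem_enum.
have /eqP := Uind s f (undup_uniq _) Uf fs0 i i_s.
by rewrite /f eqxx subr_eq0 => /eqP <-.
Qed.

(** * Generalized eigenspaces and stable subspaces *)

Section GeneralizedEigenspaces.
Context (K : fieldType) (W : lmodType K) (L : W -> W) (lL : linear L).

Definition lin_shift (a : K) (x : W) : W := L x - a *: x.

Lemma lin_shift_linear a : linear (lin_shift a).
Proof.
move=> c x y; rewrite /lin_shift lL scalerDr scalerBr scalerA [a * c]mulrC -scalerA.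
by rewrite opprD addrACA.
Qed.

Lemma iter_linear (f : W -> W) k : linear f -> linear (iter k f).
Proof. by move=> lf; elim: k => //= k IH c x y; rewrite /= IH lf. Qed.

Lemma lin_shiftC a b x : lin_shift a (lin_shift b x) = lin_shift b (lin_shift a x).
Proof.
rewrite /lin_shift !(linB lL) !(linZ lL) !scalerBr !scalerA [b * a]mulrC.
by rewrite !opprB !addrA addrAC [RHS]addrAC [in RHS](addrAC (L (L x))).
Qed.

Lemma iter_shiftC a b k x :
  iter k (lin_shift a) (lin_shift b x) = lin_shift b (iter k (lin_shift a) x).
Proof. by elim: k => //= k ->; rewrite lin_shiftC. Qed.

Lemma iter_iter_shiftC a b k m x :
  iter k (lin_shift a) (iter m (lin_shift b) x)
  = iter m (lin_shift b) (iter k (lin_shift a) x).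
Proof. by elim: m => //= m <-; rewrite iter_shiftC. Qed.

(** For [L := twL 0] this is convertible to [gen_weight_space]. *)
Definition gen_eigenspace (a : K) : set W :=
  [set x | exists k, iter k (lin_shift a) x = 0].

Lemma gen_eigenspace_subspace a : subspace (gen_eigenspace a).
Proof.
split; first by exists 0%N.
move=> c x y [k kx] [m my]; exists (k + m)%N.
rewrite (iter_linear _ (lin_shift_linear a)) {1}addnC !iterD kx my.
by rewrite !(lin0 (iter_linear _ (lin_shift_linear a))) scaler0 addr0.
Qed.

Lemma iter_shift_gen_eigenspace a b m x :
  gen_eigenspace a x -> gen_eigenspace a (iter m (lin_shift b) x).
Proof.
move=> [k kx]; exists k; rewrite iter_iter_shiftC kx.
exact: (lin0 (iter_linear _ (lin_shift_linear b))).
Qed.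

Context (U : set W) (sU : subspace U) (UL : forall x, U x -> U (L x)).

Lemma lin_shift_in_subspace a x : U x -> U (lin_shift a x).
Proof. by move=> Ux; apply: subspaceB => //; [exact: UL | exact: subspaceZ]. Qed.

(* (L - b) - (L - a) = a - b is invertible, so U contains x as soon as it
   contains (L - a) x and (L - b) x. *)
Lemma shift_injective_mod a b x :
  a != b -> gen_eigenspace a x -> U (lin_shift b x) -> U x.
Proof.
move=> ab [k kx] Ubx; suff H j : (j <= k)%N -> U (iter (k - j) (lin_shift a) x).
  by have := H k (leqnn k); rewrite subnn.
elim: j => [|j IH] jk; first by rewrite subn0 kx; exact: subspace0.
set y := iter _ _ _.
have Uay : U (lin_shift a y).
  rewrite -[lin_shift a y]/(iter (k - j.+1).+1 (lin_shift a) x) -subSn //.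
  by rewrite subSS; apply: IH; exact: ltnW.
have Uby : U (lin_shift b y).
  rewrite /y -iter_shiftC; elim: (k - j.+1)%N => //= m; exact: lin_shift_in_subspace.
apply: (subspaceZr (a := a - b)) => //; first by rewrite subr_eq0.
have -> : (a - b) *: y = lin_shift b y - lin_shift a y.
  by rewrite /lin_shift scalerBl opprB [RHS]addrC addrA subrK.
exact: subspaceB.
Qed.

Lemma iter_shift_injective_mod a b m x :
  a != b -> gen_eigenspace a x -> U (iter m (lin_shift b) x) -> U x.
Proof.
move=> ab Wx; elim: m => //= m IH Ux; apply: IH.
by apply: (shift_injective_mod ab) Ux; exact: iter_shift_gen_eigenspace.
Qed.

(** A power of [L - b] kills the component [f b] and can be cancelled modulo [U] on the components
    of other eigenvalues, which gives an induction on [s]. *)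
Lemma components_in_subspace (s : seq K) (f : K -> W) :
  uniq s -> (forall a, gen_eigenspace a (f a)) -> U (\sum_(a <- s) f a) ->
  forall a, a \in s -> U (f a).
Proof.
elim: s f => //= b s IH f /andP[bs us] Wf Us.
have [k kb] := Wf b; have lk := iter_linear k (lin_shift_linear b).
have Usf a : a \in s -> U (f a).
  move=> as_; apply: (@iter_shift_injective_mod a b k) => //.
    by apply: contraNneq bs => <-.
  apply: (IH (fun a => iter k (lin_shift b) (f a))) => //.
    by move=> c; exact: iter_shift_gen_eigenspace.
  rewrite -(lin_sum lk); move: Us; rewrite big_cons => Us.
  have : U (iter k (lin_shift b) (f b + \sum_(j <- s) f j)).
    by elim: (k) => //= m; exact: lin_shift_in_subspace.
  by rewrite (linD lk) kb add0r.
move=> a; rewrite inE => /predU1P[->|]; last exact: Usf.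
have -> : f b = \sum_(a <- b :: s) f a - \sum_(a <- s) f a.
  by rewrite big_cons addrK.
by apply: subspaceB => //; apply: subspace_sum => // i /Usf.
Qed.

(** The entries of [s] may share eigenvalues, as long as these differ from [a]. They are killed one
    after the other by powers of [L - b], each of which can be cancelled on [u] because [b] is not
    [a]. *)
Lemma component_in_subspace a u (s : seq W) :
  gen_eigenspace a u ->
  (forall y, y \in s -> exists2 b, b != a & gen_eigenspace b y) ->
  U (u - \sum_(y <- s) y) -> U u.
Proof.
move sn : (size s) => n.
elim: n s sn u => [|n IH] [|y s] //= => [_|[sn]] u Wu Ws.
  by rewrite big_nil subr0.
have [b ba [k ky]] := Ws y (mem_head _ _).
have lk := iter_linear k (lin_shift_linear b).
rewrite big_cons => Us.
apply: (@iter_shift_injective_mod a b k) => //.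
  by rewrite eq_sym.
apply: (IH (map (iter k (lin_shift b)) s)).
- by rewrite size_map.
- exact: iter_shift_gen_eigenspace.
- move=> _ /mapP[z zs ->]; have [c ca Wz] := Ws z (@mem_behead _ (y :: s) z zs).
  by exists c => //; exact: iter_shift_gen_eigenspace.
have : U (iter k (lin_shift b) (u - (y + \sum_(z <- s) z))).
  by elim: (k) => //= m; exact: lin_shift_in_subspace.
by rewrite (linB lk) (linD lk) ky add0r (lin_sum lk) big_map.
Qed.

End GeneralizedEigenspaces.

(** * Eigenspaces of automorphisms of finite order *)

Section RootsOfUnity.
Context (R : realType).
Local Notation C := R[i].

Lemma epiD (z w : C) : epi (z + w) = epi z * epi w.
Proof.
rewrite /epi mulrDr; set a := _ * z; set b := _ * w.
case: a b => [a a'] [b b']; rewrite /cexp /= expRD cosD sinD.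
by apply/eqP; rewrite eq_complex /=; apply/andP; split; apply/eqP; ring.
Qed.

Lemma epi0 : epi (0 : C) = 1.
Proof. by rewrite /epi mulr0 /cexp /= expR0 cos0 sin0 mul1r. Qed.

Lemma epi_neq0 (z : C) : epi z != 0.
Proof.
apply/eqP => z0; have /eqP := epiD z (- z).
by rewrite subrr epi0 z0 mul0r oner_eq0.
Qed.

Lemma epiN (z : C) : epi (- z) = (epi z)^-1.
Proof.
by apply: (mulfI (epi_neq0 z)); rewrite -epiD subrr epi0 divff ?epi_neq0.
Qed.

Lemma epiM (z : C) (n : nat) : epi (z * n%:R) = epi z ^+ n.
Proof.
elim: n => [|n IH]; first by rewrite mulr0 epi0.
by rewrite exprSr -IH -epiD -natr1 mulrDr mulr1.
Qed.

Lemma epi_real (x : R) : epi x%:C = cos (pi * x) +i* sin (pi * x).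
Proof.
rewrite /epi /cexp /= !(mul0r, mulr0, mul1r, addr0, subr0, add0r, oppr0).
by rewrite expR0 mul1r.
Qed.

Definition zeta (T : nat) : C := epi (2%:R / T%:R).

Lemma zeta_expT T : (0 < T)%N -> zeta T ^+ T = 1.
Proof.
move=> T0; rewrite -epiM mulfVK ?pnatr_eq0 -?lt0n //.
have -> : (2%:R : C) = (2%:R : R)%:C by rewrite rmorph_nat.
by rewrite epi_real mulr_natr cos2pi sin2pi.
Qed.

(** With [y = j / T], the real part is [1 - 2 sin^2 (pi y)], and the sine is positive as [pi y] lies
    strictly between 0 and [pi]. *)
Lemma zeta_neq1 T j : (0 < j < T)%N -> zeta T ^+ j != 1.
Proof.
move=> /andP[j0 jT]; have T0 : (0 < T)%N by exact: leq_trans jT.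
rewrite -epiM; pose y : R := j%:R / T%:R.
have -> : 2%:R / T%:R * j%:R = (2%:R * y)%:C :> C.
  by rewrite !rmorphM fmorphV /= !rmorph_nat mulrAC mulrA.
rewrite epi_real eq_complex /= negb_and; apply/orP; left.
rewrite mulrCA mulr_natl cos_mulr2n cos2sin2.
have s0 : 0 < sin (pi * y).
  apply: sin_gt0_pi; rewrite mulr_gt0 ?pi_gt0 ?divr_gt0 ?ltr0n //=.
  by rewrite gtr_pMr ?pi_gt0 // ltr_pdivrMr ?ltr0n // mul1r ltr_nat.
apply/negP => /eqP E; have : sin (pi * y) ^+ 2 = 0 by lra.
by apply/eqP; rewrite sqrf_eq0 gt_eqF.
Qed.

Lemma sum_zeta T j : (0 < j < T)%N -> \sum_(r < T) zeta T ^+ (r * j) = 0.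
Proof.
move=> jT; have T0 : (0 < T)%N by case/andP: jT => _; exact: leq_ltn_trans.
have z1 := zeta_neq1 jT; apply: (mulfI (x := zeta T ^+ j - 1)); first by rewrite subr_eq0.
under eq_bigr do rewrite mulnC exprM.
rewrite -subrX1 mulr0 -exprM mulnC exprM zeta_expT // expr1n subrr //.
Qed.

Lemma eigen_epi T r : epi (- 2%:R * (r%:R / T%:R)) = (zeta T ^+ r)^-1 :> C.
Proof. by rewrite -epiM -epiN; congr epi; ring. Qed.

End RootsOfUnity.

Section EigenDecomposition.
Context (R : realType) (V : voa R) (g : V -> V) (T : nat).
Hypotheses (lg : linear g) (T0 : (0 < T)%N) (gT : forall x, iter T g x = x).

(** Discrete Fourier transform: [f r], the average of [z^(r j) g^j v] over [j], is the component of
    [v] for the eigenvalue [z^(-r)]. The stable subspace [P] allows a decomposition inside a graded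
    piece or an eigenspace of a commuting automorphism. *)
Lemma eigen_decomposition (P : set V) v :
  subspace P -> (forall x, P x -> P (g x)) -> P v ->
  lin_span [set x | P x /\ exists2 r, (r < T)%N & eigen_gr g T r x] v.
Proof.
move=> sP Pg Pv; pose z := zeta R T.
have z0 : z != 0 by exact: epi_neq0.
have zT : z ^+ T = 1 by exact: zeta_expT.
have sz j : (0 < j < T)%N -> \sum_(r < T) z ^+ (r * j) = 0 by exact: sum_zeta.
pose f r := T%:R^-1 *: \sum_(j < T) z ^+ (r * j) *: iter j g v.
have -> : v = \sum_(r < T) f r.
  rewrite -scaler_sumr exchange_big /=; under eq_bigr do rewrite -scaler_suml.
  rewrite (bigD1 (Ordinal T0)) //= [X in _ + X]big1 => [|j j0]; last first.
    by rewrite sz ?scale0r // ltn_ord andbT lt0n; move: j0; rewrite -(inj_eq val_inj).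
  under eq_bigr do rewrite muln0 expr0.
  by rewrite sumr_const card_ord addr0 scalerA mulVf ?scale1r // pnatr_eq0 -lt0n.
apply: subspace_sum => [|r _ _]; first exact: lin_span_subspace.
apply: lin_span_subset; split.
  apply: subspaceZ => //; apply: subspace_sum => // j _ _; apply: subspaceZ => //.
  by elim: (j : nat) => //= m /Pg.
exists r => //=; rewrite /eigen_gr /= eigen_epi -/z /f (linZ lg) scalerA mulrC -scalerA.
congr (_ *: _); rewrite (lin_sum lg).
apply: (scalerI (expf_neq0 r z0)); rewrite scalerA divff ?expf_neq0 // scale1r.
rewrite scaler_sumr.
under eq_bigr do rewrite (linZ lg) scalerA -exprD -mulnS -iterS.
(* Applying [g] and multiplying by [z^r] shifts the index by one, and the sum over a full period is
   unchanged since [F T = F 0]. *)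
pose F j := z ^+ (r * j) *: iter j g v.
have FT : F T = F 0%N by rewrite /F gT mulnC exprM zT expr1n muln0 expr0.
apply: (addrI (F 0%N)); rewrite -[LHS](big_ord_recl T (F \o val)) /=.
by rewrite big_ord_recr /= FT addrC.
Qed.

End EigenDecomposition.

(** * Twisted modules *)

Section FormalSums.
Context (R : realType).
Local Notation C := R[i].

Lemma cbin0 (z : C) : cbin z 0 = 1.
Proof. by rewrite /cbin big_ord0 fact0 divr1. Qed.

Lemma cbin1 (z : C) : cbin z 1 = z.
Proof. by rewrite /cbin big_ord1 subr0 factS fact0 divr1. Qed.

Lemma cbin_small (n k : nat) : (n < k)%N -> cbin (n%:R : C) k = 0.
Proof.
by move=> nk; rewrite /cbin (bigD1 (Ordinal nk)) //= subrr !mul0r.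
Qed.

Lemma is_integer_int (m : int) : is_integer (m%:~R : C).
Proof. by exists m. Qed.

Lemma is_integer0 : is_integer (0 : C).
Proof. by exists 0. Qed.

Lemma fsum_ord (M : nmodType) (k : nat) (F : nat -> M) :
  (forall i, (k <= i)%N -> F i = 0) ->
  \sum_(i \in [set: nat]) F i = \sum_(i < k) F i.
Proof.
move=> F0; rewrite fsbig_ord; symmetry; apply: fsbig_widen => //= i [_ /negP].
by rewrite -leqNgt; exact: F0.
Qed.

(** Taking [p = 0] makes the binomial power equal to 1. With the analogous fact for [delta_right],
    the Jacobi identity then becomes the commutator formula. *)
Lemma delta_left_nat (M : lmodType C) (F : C -> C -> M) q s :
  delta_left 0 F 0 q s = F q s.
Proof.
rewrite /delta_left subr0 asboolT; last exact: is_integer0.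
rewrite (fsum_ord (k := 1)) => [|i i0]; last first.
  by rewrite (cbin_small i0) mulr0 scale0r.
by rewrite big_ord1 cbin0 mul1r scale1r subr0 add0r addr0.
Qed.

Lemma delta_right_nat (M : lmodType C) (F : C -> C -> M) q s :
  delta_right 0 F 0 q s = F q s.
Proof.
rewrite /delta_right subr0 asboolT; last exact: is_integer0.
rewrite (fsum_ord (k := 1)) => [|i i0]; last first.
  by rewrite (cbin_small i0) mulr0 scale0r.
by rewrite big_ord1 cbin0 subr0 epi0 mul1r scale1r subr0 add0r addr0.
Qed.

Lemma natr_neqN1 (i : nat) : (i%:R == -1 :> C) = false.
Proof. by apply/negbTE; rewrite -subr_eq0 opprK natr1 pnatr_eq0. Qed.

End FormalSums.

(** * The grading of the vertex operator algebra and its automorphisms *)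

Section Grading.
Context (R : realType) (V : voa R).

Lemma voa_gr_subspace n : subspace (@voa_gr R V n).
Proof. by case: (voa_direct_sum V). Qed.

Lemma voa_L0_linear : linear (@voaL R V 0).
Proof. exact: voa_linearr. Qed.

(** This converse of [voa_L0] is what makes automorphisms preserve the grading: they fix the
    conformal vector, hence commute with [L(0)]. *)
Lemma voa_gr_L0 (n : int) (v : V) : voaL 0 v = n%:~R *: v -> voa_gr n v.
Proof.
have sn := voa_gr_subspace n.
have [_ gen _] := voa_direct_sum V.
have [s [f [Vf ->]]] := gen v.
(* Modulo [voa_gr n], the summands are removed one by one: one of degree [n] is absorbed, and one of
   degree [a] other than [n] is killed by [L(0) - a], which multiplies [y] by the nonzero scalar
   [n - a]. *)
suff H y : voaL 0 y = n%:~R *: y -> voa_gr n (y - \sum_(i <- s) f i) ->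
    voa_gr n y.
  by move=> /H; apply; rewrite subrr; exact: subspace0.
elim: s f Vf y => [|a s IH] f Vf y L0y; first by rewrite big_nil subr0.
rewrite big_cons => Hy; have [an|an] := eqVneq a n.
  apply: (IH f) => //.
  have -> : y - \sum_(i <- s) f i = y - (f a + \sum_(i <- s) f i) + f a.
    by rewrite opprD addrA addrAC subrK.
  by apply: subspaceD => //; rewrite -an.
have c0 : (n - a)%:~R != 0 :> R[i] by rewrite intr_eq0 subr_eq0 eq_sym.
apply: (IH (fun i => ((i - a)%:~R / (n - a)%:~R) *: f i)) => // [i|].
  by apply: subspaceZ => //; exact: voa_gr_subspace.
apply: (subspaceZr (a := (n - a)%:~R)) => //.
have {Hy} : voa_gr n (lin_shift (voaL 0) a%:~R (y - (f a + \sum_(j <- s) f j))).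
  rewrite /lin_shift (voa_L0 Hy) -scalerBl; exact: subspaceZ.
rewrite (linB (lin_shift_linear voa_L0_linear _)) (linD (lin_shift_linear voa_L0_linear _)).
rewrite (lin_sum (lin_shift_linear voa_L0_linear _)) /lin_shift L0y.
rewrite (voa_L0 (Vf a)) subrr add0r.
rewrite scalerBr scaler_sumr -scalerBl -intrB.
congr (voa_gr n (_ - _)); apply: eq_bigr => j _.
by rewrite (voa_L0 (Vf j)) -scalerBl -intrB scalerA mulrC mulfVK.
Qed.

Context (g : V -> V) (hg : voa_automorphism g).

Lemma aut_gr n (v : V) : voa_gr n v -> voa_gr n (g v).
Proof.
move=> gv; apply: voa_gr_L0.
rewrite /voaL -{1}(aut_conformal hg) -(aut_Y hg) -/(voaL 0 v) (voa_L0 gv).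
exact: (linZ (aut_linear hg)).
Qed.

Lemma eigen_gr_subspace T r : subspace (eigen_gr g T r).
Proof.
split=> [|a x y]; rewrite /eigen_gr /=; first by rewrite (lin0 (aut_linear hg)) scaler0.
by move=> xE yE; rewrite (aut_linear hg) xE yE scalerDr !scalerA mulrC.
Qed.

Lemma eigen_gr0 T v : g v = v -> eigen_gr g T 0 v.
Proof. by move=> gv; rewrite /eigen_gr /= mul0r mulr0 epi0 scale1r. Qed.

Lemma eigen_gr_vacuum T r (v : V) n :
  eigen_gr g T r v -> eigen_gr g T r (voaY v n (vacuum V)).
Proof.
rewrite /eigen_gr /= (aut_Y hg) (aut_vacuum hg) => ->.
exact: (linZ (voa_linearl _ _)).
Qed.

Lemma voa_lin_span (v : V) T : has_order g T ->
  lin_span [set x | exists r, (r < T)%N /\ eigen_gr g T r x] v.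
Proof.
move=> [T0 gT _].
have := eigen_decomposition (aut_linear hg) T0 gT (P := setT) (v := v).
have -> : [set x : V | setT x /\ exists2 r, (r < T)%N & eigen_gr g T r x]
  = [set x | exists r, (r < T)%N /\ eigen_gr g T r x].
  by apply/seteqP; split=> [x [_ [r]]|x [r []]]; [exists r | split=> //; exists r].
by apply.
Qed.

End Grading.

(** * Weights of modes on twisted modules *)

Section Weights.
Context (R : realType) (V : voa R) (g : V -> V) (T : nat).
Hypotheses (hg : voa_automorphism g) (hT : has_order g T).
Context (W : twisted_module g T).

Let T0 : (0 < T)%N. Proof. by case: hT. Qed.

(** Since [L(-1) v = v_{-2} 1], the property follows from the Jacobi identity for [v] and the
    vacuum, applied to eigenvectors [v] first. *)
Lemma tw_derivative (v : V) n (w : W) :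
  twY (voaL (-1) v) n w = - n *: twY v (n - 1) w.
Proof.
have lhs : linear (fun v => twY (voaL (-1) v) n w).
  move=> c x y; rewrite /voaL voa_linearr.
  exact: (tw_linearl n w).
have rhs : linear (fun v => - n *: twY v (n - 1) w : W).
  by move=> c x y; rewrite (tw_linearl (n - 1) w) scalerDr !scalerA mulrC.
pose D := [set v | twY (voaL (-1) v) n w = - n *: twY v (n - 1) w].
suff : D v by [].
have sD : subspace D.
  rewrite (_ : D = (fun v => twY (voaL (-1) v) n w - (- n *: twY v (n - 1) w : W))
      @^-1` [set 0]); last first.
    apply/seteqP; split=> x /=; first by rewrite /D /= => ->; rewrite subrr.
    by move/eqP; rewrite subr_eq0 => /eqP.
  apply: linear_preim; last exact: subspace_set1.
  by move=> c x y; rewrite lhs rhs scalerBr opprD addrACA.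
apply: (lin_span_min sD _ (voa_lin_span hg v hT)) => {v} v [r [rT ev]].
rewrite /D /=.
have L1 : voaL (-1) v = voaY v (-2) (vacuum V).
  rewrite -[LHS]voa_creation voa_derivative opprK scale1r.
  by congr (voaY _ _ _); ring.
rewrite L1.
(* Outside the coset of exponents of [v] the delta series gives no information, but there both modes
   vanish. *)
have [nr|nr] := pselect (is_integer (n + r%:R / T%:R)); last first.
  rewrite (tw_modes_eigen (r := r)) //; last exact: eigen_gr_vacuum.
  rewrite (tw_modes_eigen (r := r)) ?scaler0 // => -[m mE]; apply: nr.
  by exists (m + 1); rewrite intrD -mE; ring.
(* The left side involves only vacuum modes of index [i] or [-2 - i], never [-1], so it vanishes. On
   the right only the terms with [v_{-2} 1] and [v_{-1} 1 = v] survive. *)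
have := tw_jacobi (vacuum V) w (-2) n 0 rT ev.
rewrite /delta_left /delta_right /delta_iter !subr0 opprK !asboolT //; last first.
  exact: (is_integer_int _ (-2)).
rewrite fsbig1 => [|i _]; last first.
  by rewrite tw_vacuum add0r natr_neqN1 (lin0 (tw_linearr _ _)) scaler0.
rewrite fsbig1 => [|i _]; last first.
  rewrite tw_vacuum addr0 (_ : -2 - i%:R == -1 = false) ?scaler0 //.
  by rewrite -(natr_neqN1 R i) -subr_eq0 -[RHS]subr_eq0 -oppr_eq0; congr (_ == _); ring.
rewrite subr0 (fsum_ord (k := 2)) => [|i i2].
  rewrite !big_ord_recl big_ord0 /= cbin0 cbin1 scale1r !addr0 !subr0.
  rewrite (_ : -2 + _ = -1); last by rewrite /bump /=; ring.
  by rewrite voa_creation scaleNr => /eqP; rewrite eq_sym addr_eq0 => /eqP.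
rewrite (_ : -2 + i%:R = (i - 2)%:R); last by rewrite natrB // addrC.
by rewrite voa_creation_regular (lin0 (tw_linearl _ _)) scaler0.
Qed.

(** The commutator formula gives [[L(0), v_m] = (L(-1) v)_{m+1} + (L(0) v)_m], and the first term is
    [-(m + 1) v_m]. *)
Lemma tw_L0_mode n (v : V) m (w : W) : voa_gr n v ->
  twL 0 (twY v m w) = twY v m (twL 0 w) + (n%:~R - m - 1) *: twY v m w.
Proof.
move=> gv.
have := tw_jacobi v w 0 1 m T0 (eigen_gr0 T (aut_conformal hg)).
rewrite delta_left_nat delta_right_nat /delta_iter mul0r oppr0 subr0 asboolT; last first.
  exact: (is_integer_int _ 1).
rewrite (fsum_ord (k := 2)) => [|i i2]; last by rewrite (cbin_small _ i2) scale0r.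
rewrite !big_ord_recl big_ord0 /= cbin0 cbin1 scale1r subr0 !addr0 !add0r /bump /=.
rewrite scale1r [1 + m]addrC addrK.
have -> : voaY (conformal V) 0 v = voaL (-1) v by rewrite /voaL addNr.
have -> : voaY (conformal V) 1 v = voaL 0 v by rewrite /voaL add0r.
rewrite (voa_L0 gv) tw_derivative (linZ (tw_linearl _ _)) addrK -scalerDl.
move=> /eqP; rewrite subr_eq addrC => /eqP E.
by rewrite /twL add0r E [LHS]addrC; congr (_ + _); congr (_ *: _); ring.
Qed.

Lemma tw_L0_linear : linear (twL (W := W) 0).
Proof. exact: tw_linearr. Qed.

Lemma gen_weight_subspace a : subspace (gen_weight_space (W := W) a).
Proof. exact: (gen_eigenspace_subspace tw_L0_linear). Qed.

Lemma tw_mode_weight n (v : V) m a (w : W) : voa_gr n v ->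
  gen_weight_space a w -> gen_weight_space (a + n%:~R - m - 1) (twY v m w).
Proof.
move=> gv [k kw]; exists k.
suff -> : forall j, iter j (lin_shift (twL (W := W) 0) (a + n%:~R - m - 1)) (twY v m w)
    = twY v m (iter j (lin_shift (twL (W := W) 0) a) w).
  by rewrite kw (lin0 (tw_linearr _ _)).
elim=> //= j ->; set x := iter j _ _.
rewrite /lin_shift (tw_L0_mode _ _ gv) (linB (tw_linearr _ _)) (linZ (tw_linearr _ _)).
rewrite -addrA -scalerBl; congr (_ + _); rewrite -scaleNr; congr (_ *: _); ring.
Qed.

End Weights.

(** * Homogeneous generators of cofinite modules *)

Section HomogeneousGeneration.
Context (R : realType) (V : voa R) (g g' : V -> V) (T T' : nat).
Hypotheses (hg : voa_automorphism g) (hg' : voa_automorphism g').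
Hypotheses (hT : has_order g T) (hT' : has_order g' T').
Hypothesis (gC : forall v, g (g' v) = g' (g v)).
Context (W : twisted_module g T).

(* The generators of C_1(W) of weight h; r = 0 and r > 0 are treated uniformly,
   wt v + r / T > 0 being the condition on wt v in both cases. *)
Inductive mode_generator (h : R[i]) : W -> Prop := ModeGenerator r r' v n w of
    (r < T)%N & (r' < T')%N & eigen_gr g T r v & eigen_gr g' T' r' v &
    voa_gr n v & 0 < n%:~R + r%:R / T%:R :> R[i] &
    gen_weight_space (h - (n%:~R + r%:R / T%:R)) w :
  mode_generator h (twY v (- 1 - r%:R / T%:R) w).

Lemma mode_generator_weight h x : mode_generator h x -> gen_weight_space h x.
Proof.
case=> r r' v n w rT r'T' ev ev' gv n0 ww.
have := tw_mode_weight hg hT (-1 - r%:R / T%:R) gv ww.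
by congr (gen_weight_space _ _); ring.
Qed.

Lemma eigen_gr_commute r v : eigen_gr g T r v -> eigen_gr g T r (g' v).
Proof. by rewrite /eigen_gr /= gC => ->; rewrite (linZ (aut_linear hg')). Qed.

(** [W] is [C1] plus a finite span, whose spanning vectors are split into weight components. The
    generators of [C1] are split further into joint eigenvectors of [g] and [g'], the form in which
    the Jacobi identity for intertwining operators applies. [graded_generation] then works weight by
    weight. *)
Lemma homogeneous_generation : generalized W -> C1_cofinite W ->
  exists B : seq (R[i] * W),
    (forall p, p \in B -> gen_weight_space p.1 p.2) /\
    forall h x, gen_weight_space h x ->
      lin_span ([set y | (h, y) \in B] `|` mode_generator h) x.
Proof.
move=> [Wsum _] [d [b [_ gb _]]].
have /choice[sf sfP] : forall i, exists sf : seq R[i] * (R[i] -> W),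
    (forall a, gen_weight_space a (sf.2 a)) /\ b i = \sum_(a <- sf.1) sf.2 a.
  by move=> i; have [_ /(_ (b i))[s [f [? ?]]] _] := Wsum; exists (s, f).
pose B := [seq (a, (sf i).2 a) | i <- enum 'I_d, a <- (sf i).1].
have BP p : p \in B -> gen_weight_space p.1 p.2.
  by move=> /allpairsPdep[i [a [_ _ ->]]] /=; have [] := sfP i.
exists B; split=> //.
pose G h := lin_span ([set y | (h, y) \in B] `|` mode_generator h).
have sG h : subspace (G h) by exact: lin_span_subspace.
apply: (graded_generation (G := G) Wsum) => // [h|x].
  apply: lin_span_min; first exact: (gen_weight_subspace W).
  by move=> y [/BP|/mode_generator_weight].
set Z := lin_span _; have sZ : subspace Z by exact: lin_span_subspace.
have GZ h y : G h y -> Z y by move=> Gy; apply: lin_span_subset; exists h.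
have bZ i : Z (b i).
  have [_ ->] := sfP i; apply: subspace_sum => // a a_s _.
  apply: (GZ a); apply: lin_span_subset; left.
  by apply/allpairsPdep; exists i, a; rewrite mem_enum.
(* By bilinearity [v] may be replaced by its [g']-components, which keep its degree and
   [g]-eigenvalue, and [w] by its weight components. *)
have modeZ r n v w : (r < T)%N -> eigen_gr g T r v -> voa_gr n v ->
    0 < n%:~R + r%:R / T%:R :> R[i] -> Z (twY v (- 1 - r%:R / T%:R) w).
  move=> rT ev gv n0; have [T'0 gT' _] := hT'.
  have sZv := linear_preim (tw_linearl (- 1 - r%:R / T%:R) w) sZ.
  pose P := @voa_gr R V n `&` eigen_gr g T r.
  have sP : subspace P.
    by apply: subspace_setI; [exact: voa_gr_subspace | exact: eigen_gr_subspace].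
  have Pg' y : P y -> P (g' y).
    by move=> [? ?]; split; [exact: aut_gr | exact: eigen_gr_commute].
  have vP := eigen_decomposition (aut_linear hg') T'0 gT' sP Pg' (conj gv ev).
  apply: (lin_span_min sZv _ vP) => u [[gu eu] [r' r'T' eu']].
  have sZw := linear_preim (tw_linearr u (- 1 - r%:R / T%:R)) sZ.
  apply: (lin_span_min sZw _ (direct_sum_lin_span w Wsum)) => y [a ya].
  apply: (GZ (a + (n%:~R + r%:R / T%:R))); apply: lin_span_subset; right.
  by apply: (ModeGenerator (r' := r') (n := n)) => //; rewrite addrK.
have C1Z : C1 (W := W) `<=` Z.
  apply: lin_span_min => // _
    [[v [w [n [ev gv n0 ->]]]]|[r [v [w [n [/andP[r0 rT] ev gv n0 ->]]]]]].
    have [T0 _ _] := hT; have := modeZ 0%N n v w T0 ev gv.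
    by rewrite mul0r addr0 subr0; apply; rewrite ltr0z.
  apply: (modeZ r n) => //; rewrite ltr_wpDl ?ler0z // divr_gt0 ?ltr0n //.
  exact: leq_ltn_trans rT.
have [c /C1Z xc] := gb x I.
rewrite -[x](subrK (\sum_(i < d) c i *: b i)); apply: subspaceD => //.
by apply: subspace_sum => // i _ _; exact: subspaceZ.
Qed.

End HomogeneousGeneration.

(** * Intertwining operators *)

Section DeltaSums.
Context (R : realType) (M : lmodType R[i]) (U : set M) (sU : subspace U).
Implicit Types (F : R[i] -> R[i] -> M).

Lemma delta_left_sub a F p q s :
  (forall i : nat, U (F (p + q - i%:R) (s + i%:R))) -> U (delta_left a F p q s).
Proof.
move=> UF; rewrite /delta_left; case: asboolP => _; last exact: subspace0.
by apply: subspace_fsum => // i; exact: subspaceZ.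
Qed.

Lemma delta_right_sub a F p q s :
  (forall i : nat, U (F (q + i%:R) (p + s - i%:R))) ->
  U (delta_right a F p q s).
Proof.
move=> UF; rewrite /delta_right; case: asboolP => _; last exact: subspace0.
by apply: subspace_fsum => // i; exact: subspaceZ.
Qed.

Lemma delta_iter_sub a F p q s :
  (forall i : nat, U (F (p + i%:R) (q + s - i%:R))) ->
  U (delta_iter a F p q s).
Proof.
move=> UF; rewrite /delta_iter; case: asboolP => _; last exact: subspace0.
by apply: subspace_fsum => // i; exact: subspaceZ.
Qed.

(** This isolates the leading mode in a delta sum. The bound [k] guarantees finite support, without
    which the sum would be 0 by convention. *)
Lemma fsum_head k (c : nat -> R[i]) (f : nat -> M) : c 0%N != 0 ->
  (forall i, (k <= i)%N -> f i = 0) -> (forall i, U (f i.+1)) ->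
  U (\sum_(i \in [set: nat]) c i *: f i) -> U (f 0%N).
Proof.
move=> c0 f0 Uf; rewrite (fsum_ord (k := k.+1)) => [|i /ltnW /f0 ->]; last first.
  by rewrite scaler0.
rewrite big_ord_recl /= => Us; apply: (subspaceZr (a := c 0%N)) => //.
rewrite -[_ *: _](addrK (\sum_(i < k) c (bump 0 i) *: f (bump 0 i))).
by apply: subspaceB => //; apply: subspace_sum => // i _ _; exact: subspaceZ.
Qed.

End DeltaSums.

Section IntertwiningOperators.
Context (R : realType) (V : voa R) (g1 g2 : V -> V) (T1 T2 T3 : nat).
Local Notation g3 := (fun v : V => g1 (g2 v)).
Hypotheses (hg1 : voa_automorphism g1) (hg2 : voa_automorphism g2).
Hypothesis gC : forall v : V, g1 (g2 v) = g2 (g1 v).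
Hypotheses (hT1 : has_order g1 T1) (hT2 : has_order g2 T2).
Hypothesis hT3 : has_order g3 T3.
Context (W1 : twisted_module g1 T1) (W2 : twisted_module g2 T2).
Context (W3 : twisted_module g3 T3).

Lemma aut_comp : voa_automorphism g3.
Proof.
split=> [c x y||||v n u].
- by rewrite (aut_linear hg2) (aut_linear hg1).
- exact: bij_comp (aut_bijective hg1) (aut_bijective hg2).
- by rewrite (aut_vacuum hg2) (aut_vacuum hg1).
- by rewrite (aut_conformal hg2) (aut_conformal hg1).
- by rewrite (aut_Y hg2) (aut_Y hg1).
Qed.

Let hg3 := aut_comp.

Lemma joint_eigen_lin_span (v : V) :
  lin_span [set x | exists r1 r2,
    [/\ (r1 < T1)%N, (r2 < T2)%N, eigen_gr g1 T1 r1 x & eigen_gr g2 T2 r2 x]] v.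
Proof.
set A := mkset _; have sA := lin_span_subspace A.
apply: (lin_span_min sA _ (voa_lin_span hg1 v hT1)) => {}v [r1 [r1T ev1]].
have [T20 gT2 _] := hT2.
have Pg y : eigen_gr g1 T1 r1 y -> eigen_gr g1 T1 r1 (g2 y).
  exact: (eigen_gr_commute hg2 gC).
have := eigen_decomposition (aut_linear hg2) T20 gT2 (eigen_gr_subspace hg1 T1 r1) Pg ev1.
apply: (lin_span_min sA) => x [ex1 [r2 r2T ex2]].
by apply: lin_span_subset; exists r1, r2.
Qed.

Context (I : W1 -> W2 -> R[i] -> nat -> W3) (hI : intertwining I).

(** The commutator formula with the conformal vector produces an extra term [I (L(-1) w1) w2] at
    [n + 1], which the derivative property turns into the last two terms. *)
Lemma int_L0 w1 w2 n k :
  twL 0 (I w1 w2 n k) = I (twL 0 w1) w2 n k + I w1 (twL 0 w2) n k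
    - (n + 1) *: I w1 w2 n k + k.+1%:R *: I w1 w2 n k.+1.
Proof.
have [T10 _ _] := hT1; have [T20 _ _] := hT2.
have := int_jacobi hI w1 w2 0 1 n k T10 T20
  (eigen_gr0 T1 (aut_conformal hg1)) (eigen_gr0 T2 (aut_conformal hg2)).
rewrite !mul0r !oppr0 delta_left_nat delta_right_nat /delta_iter subr0.
rewrite asboolT; last exact: (is_integer_int _ 1).
rewrite (fsum_ord (k := 2)) => [|i i2]; last by rewrite (cbin_small _ i2) scale0r.
rewrite !big_ord_recl big_ord0 /= cbin0 cbin1 scale1r subr0 !addr0 !add0r /bump /=.
rewrite scale1r [1 + n]addrC addrK.
have := int_derivative hI w1 w2 (n + 1) k.
rewrite addrK /twL addNr add0r => -> /eqP; rewrite subr_eq => /eqP ->.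
rewrite scaleNr -!addrA [LHS]addrC -!addrA [LHS]addrC -!addrA.
by congr (_ + _); rewrite addrC -!addrA addrC -!addrA.
Qed.

Lemma int_lin0l w2 n k : I 0 w2 n k = 0.
Proof. exact: (lin0 (int_linearl hI w2 n k)). Qed.

Lemma int_lin0r w1 n k : I w1 0 n k = 0.
Proof. exact: (lin0 (int_linearr hI w1 n k)). Qed.

(** By [int_L0], applying [L(0) - c] to a coefficient yields one with [(L(0) - a) w1], one with
    [(L(0) - b) w2] and one with a higher power of the logarithm. The outer induction is on the
    nilpotency exponents, the inner one descends from the bound on powers of the logarithm. *)
Lemma int_weight a b w1 w2 n k :
  gen_weight_space a w1 -> gen_weight_space b w2 ->
  gen_weight_space (a + b - n - 1) (I w1 w2 n k).
Proof.
set c := a + b - n - 1; have sc := gen_weight_subspace W3 c.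
move=> [i ia] [j jb]; move: {2}(i + j)%N (leqnn (i + j)) => m.
elim: m w1 w2 i j ia jb k => [|m IH] w1 w2 i j ia jb k ijm.
  have i0 : i = 0%N by lia.
  by move: ia; rewrite i0 /= => ->; rewrite int_lin0l; exact: subspace0.
case: i => [|i] in ia ijm *.
  by move: ia => /= ->; rewrite int_lin0l; exact: subspace0.
case: j => [|j] in jb ijm *.
  by move: jb => /= ->; rewrite int_lin0r; exact: subspace0.
have [K IK] := int_log hI w1 w2 n.
have [d] : exists d, (K <= k + d)%N by exists K; exact: leq_addl.
elim: d k => [|d IHd] k Kk.
  by rewrite IK ?addn0 //; [exact: subspace0 | rewrite addn0 in Kk].
suff [l lP] : gen_weight_space c (twL 0 (I w1 w2 n k) - c *: I w1 w2 n k).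
  by exists l.+1; rewrite iterSr.
have -> : twL 0 (I w1 w2 n k) - c *: I w1 w2 n k =
    I (twL 0 w1 - a *: w1) w2 n k + I w1 (twL 0 w2 - b *: w2) n k
    + k.+1%:R *: I w1 w2 n k.+1.
  rewrite int_L0 (linB (int_linearl hI w2 n k)) (linZ (int_linearl hI w2 n k)).
  rewrite (linB (int_linearr hI w1 n k)) (linZ (int_linearr hI w1 n k)).
  rewrite addrAC; congr (_ + _); rewrite -!scaleNr -!addrA; congr (_ + _).
  rewrite [RHS]addrCA; congr (_ + _); rewrite -!scalerDl; congr (_ *: _).
  by rewrite /c; ring.
apply: subspaceD => //; first apply: subspaceD => //.
- by apply: (IH _ _ i j.+1); [move: ia; rewrite iterSr | exact: jb | lia].
- by apply: (IH _ _ i.+1 j); [exact: ia | move: jb; rewrite iterSr | lia].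
- by apply: subspaceZ => //; apply: IHd; rewrite addSnnS.
Qed.

Definition int_image : set W3 :=
  lin_span [set x | exists w1 w2 n k, x = I w1 w2 n k].

Lemma int_image_mem w1 w2 n k : int_image (I w1 w2 n k).
Proof. by apply: lin_span_subset; exists w1, w2, n, k. Qed.

(** In the Jacobi identity all terms except those of [delta_left] are values of [I]. The leading
    term of [delta_left] is the wanted one, and its other terms have a larger index on [I], so the
    induction descends from the truncation bound. *)
Lemma int_image_submodule : submodule int_image.
Proof.
have sZ : subspace int_image by exact: lin_span_subspace.
split=> // v m w; apply: (lin_span_min (linear_preim (tw_linearr v m) sZ)).
move=> _ [w1 [w2 [n [k ->]]]] /=.
apply: (lin_span_min (linear_preim (tw_linearl m (I w1 w2 n k)) sZ) _
  (joint_eigen_lin_span v)) => {}v [r1 [r2 [r1T r2T ev1 ev2]]] /=.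
have [N NP] := int_truncation hI w1 w2 n.
suff H d j m' : (N <= j + d)%N -> int_image (twY v m' (I w1 w2 (n + j%:R) k)).
  by have := H N 0%N m (leq_addl _ _); rewrite addr0.
elim: d j m' => [|d IH] j m' jd.
  rewrite NP; last by rewrite addn0 in jd.
  by rewrite (lin0 (tw_linearr _ _)); exact: subspace0.
(* With this [p] the integrality condition of [delta_left] holds, and the second exponent [m' - p]
   makes [m'] the leading mode of [v]. *)
set p := - (r1%:R / T1%:R) : R[i].
have /eqP := int_jacobi hI w1 w2 p (m' - p) (n + j%:R) k r1T r2T ev1 ev2.
rewrite subr_eq => /eqP Jac.
have : int_image (delta_left p (fun m n => twY v m (I w1 w2 n k)) p (m' - p) (n + j%:R)).
  rewrite Jac; apply: subspaceD => //.
    by apply: delta_iter_sub => // i; exact: int_image_mem.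
  by apply: delta_right_sub => // i; exact: int_image_mem.
rewrite /delta_left subrr asboolT; last exact: is_integer0.
move=> /(fsum_head (k := N) sZ).
rewrite expr0 cbin0 mulr1 addr0 subr0 [p + _]addrC subrK; apply.
- exact: oner_neq0.
- move=> i Ni; rewrite -addrA -natrD NP; last by lia.
  exact: (lin0 (tw_linearr _ _)).
- by move=> i; rewrite -addrA -natrD; apply: IH; lia.
Qed.

(** * Reduction to smaller total weight modulo a hyperplane *)

Section ReductionModuloHyperplane.
Context (H M : set W3) (lam : R[i]) (sH : subspace H).
Hypothesis IM : forall w1 w2 n k, M (I w1 w2 n k).
Hypothesis Hweight : forall a, a <> lam -> gen_weight_space a `<=` H.
Hypothesis Hmode : forall v (n : int) m a x, voa_gr n v -> M x ->
  gen_weight_space a x -> 0 < n%:~R - m - 1 -> H (twY v m x).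

(** The wanted value leads [delta_iter]. The later terms there lower the weight of the left
    argument, [delta_left] consists of positive-weight modes and lies in [H], and [delta_right]
    moves [v] to [w2], changing the total weight by [r2 / T2 - r1 / T1 - (i + 1)], which is
    negative. *)
Lemma reduce_left r1 r2 v n h1 h2 w1 w2 :
  (r1 < T1)%N -> (r2 < T2)%N -> eigen_gr g1 T1 r1 v -> eigen_gr g2 T2 r2 v ->
  voa_gr n v -> 0 < n%:~R + r1%:R / T1%:R :> R[i] ->
  gen_weight_space (h1 - (n%:~R + r1%:R / T1%:R)) w1 ->
  gen_weight_space h2 w2 ->
  (forall i x m, gen_weight_space (h1 - i.+1%:R) x -> H (I x w2 m 0%N)) ->
  (forall i y m, gen_weight_space (h2 + n%:~R + r2%:R / T2%:R - i.+1%:R) y ->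
    H (I w1 y m 0%N)) ->
  forall m, H (I (twY v (- 1 - r1%:R / T1%:R) w1) w2 m 0%N).
Proof.
move=> r1T r2T ev1 ev2 gv n0 ww1 ww2 IHl IHr m.
have [N NP] := tw_truncation w1 r1T ev1.
set p := - 1 - _; set q := - (r2%:R / T2%:R) : R[i].
have Jac := int_jacobi hI w1 w2 p q (m - q) 0 r1T r2T ev1 ev2.
have : H (delta_iter q (fun m n => I (twY v m w1) w2 n 0%N) p q (m - q)).
  rewrite -Jac; apply: subspaceB => //.
    apply: delta_left_sub => // i; apply: Hmode (gv) (IM _ _ _ _) (int_weight _ _ ww1 ww2) _.
    have -> : n%:~R - (p + q - i%:R) - 1
        = n%:~R + r1%:R / T1%:R + (r2%:R / T2%:R + i%:R) by rewrite /p /q; ring.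
    by rewrite ltr_wpDr // addr_ge0 ?divr_ge0 ?ler0n.
  apply: delta_right_sub => // i; apply: (IHr i).
  have := tw_mode_weight hg2 hT2 (q + i%:R) gv ww2.
  by congr (gen_weight_space _ _); rewrite /q -natr1; ring.
rewrite /delta_iter subrr asboolT; last exact: is_integer0.
(* The successor accounts for the [-1] in [p], as [p + (i + 1) = i - r1 / T1]. *)
move=> /(fsum_head (k := `|N|.+1) sH).
rewrite cbin0 addr0 subr0 [q + _]addrC subrK; apply.
- exact: oner_neq0.
- move=> [|i] // Ni.
  have -> : p + i.+1%:R = i%:Z%:~R - r1%:R / T1%:R.
    by rewrite /p -natr1 -pmulrn; ring.
  by rewrite NP ?int_lin0l //; lia.
- move=> i; apply: (IHl i).
  have := tw_mode_weight hg1 hT1 (p + i.+1%:R) gv ww1.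
  by congr (gen_weight_space _ _); rewrite /p; ring.
Qed.

(** Mirror image of [reduce_left]: the wanted value now leads [delta_right], with nonzero
    coefficient [epi p], and [delta_iter] moves [v] to [w1]. *)
Lemma reduce_right r1 r2 v n h1 h2 w1 w2 :
  (r1 < T1)%N -> (r2 < T2)%N -> eigen_gr g1 T1 r1 v -> eigen_gr g2 T2 r2 v ->
  voa_gr n v -> 0 < n%:~R + r2%:R / T2%:R :> R[i] ->
  gen_weight_space h1 w1 ->
  gen_weight_space (h2 - (n%:~R + r2%:R / T2%:R)) w2 ->
  (forall i x m, gen_weight_space (h1 + n%:~R + r1%:R / T1%:R - i.+1%:R) x ->
    H (I x w2 m 0%N)) ->
  (forall i y m, gen_weight_space (h2 - i.+1%:R) y -> H (I w1 y m 0%N)) ->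
  forall m, H (I w1 (twY v (- 1 - r2%:R / T2%:R) w2) m 0%N).
Proof.
move=> r1T r2T ev1 ev2 gv n0 ww1 ww2 IHl IHr m.
have [N NP] := tw_truncation w2 r2T ev2.
set q := - 1 - _; set p := - (r1%:R / T1%:R) : R[i].
have isolate (A B C : W3) : A - B = C -> B = A - C by move=> <-; rewrite subKr.
have /isolate Jac := int_jacobi hI w1 w2 p q (m - p) 0 r1T r2T ev1 ev2.
rewrite -/p in Jac.
have : H (delta_right p (fun m n => I w1 (twY v m w2) n 0%N) p q (m - p)).
  rewrite Jac; apply: subspaceB => //.
    apply: delta_left_sub => // i; apply: Hmode (gv) (IM _ _ _ _) (int_weight _ _ ww1 ww2) _.
    have -> : n%:~R - (p + q - i%:R) - 1
        = n%:~R + r2%:R / T2%:R + (r1%:R / T1%:R + i%:R) by rewrite /p /q; ring.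
    by rewrite ltr_wpDr // addr_ge0 ?divr_ge0 ?ler0n.
  apply: delta_iter_sub => // i; apply: (IHl i).
  have := tw_mode_weight hg1 hT1 (p + i%:R) gv ww1.
  by congr (gen_weight_space _ _); rewrite /p -natr1; ring.
rewrite /delta_right subrr asboolT; last exact: is_integer0.
move=> /(fsum_head (k := `|N|.+1) sH).
rewrite cbin0 addr0 !subr0 mulr1 [p + _]addrC subrK; apply.
- exact: epi_neq0.
- move=> [|i] // Ni.
  have -> : q + i.+1%:R = i%:Z%:~R - r2%:R / T2%:R.
    by rewrite /q -natr1 -pmulrn; ring.
  by rewrite NP ?int_lin0r //; lia.
- move=> i; apply: (IHr i).
  have := tw_mode_weight hg2 hT2 (q + i.+1%:R) gv ww2.
  by congr (gen_weight_space _ _); rewrite /q; ring.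
Qed.

End ReductionModuloHyperplane.

End IntertwiningOperators.

(** * Finiteness *)

Section Finiteness.
Context (R : realType) (V : voa R) (g1 g2 : V -> V) (T1 T2 T3 : nat).
Local Notation g3 := (fun v : V => g1 (g2 v)).
Hypotheses (hg1 : voa_automorphism g1) (hg2 : voa_automorphism g2).
Hypothesis gC : forall v : V, g1 (g2 v) = g2 (g1 v).
Hypotheses (hT1 : has_order g1 T1) (hT2 : has_order g2 T2).
Hypothesis hT3 : has_order g3 T3.
Context (W1 : twisted_module g1 T1) (W2 : twisted_module g2 T2).
Context (W3 : twisted_module g3 T3).

(** * Determination of an operator modulo the hyperplane by finitely many coefficients *)

Section Determination.
Context (I : W1 -> W2 -> R[i] -> nat -> W3) (hI : intertwining I).
Context (H M : set W3) (lam : R[i]) (sH : subspace H).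
Hypothesis IM : forall w1 w2 n k, M (I w1 w2 n k).
Hypothesis Hweight : forall a, a <> lam -> gen_weight_space a `<=` H.
Hypothesis Hmode : forall v (n : int) m a x, voa_gr n v -> M x ->
  gen_weight_space a x -> 0 < n%:~R - m - 1 -> H (twY v m x).
Context (B1 : seq (R[i] * W1)) (B2 : seq (R[i] * W2)).
Hypotheses (hW1 : generalized W1) (hW2 : generalized W2).
Hypothesis homB1 : forall p, p \in B1 -> gen_weight_space p.1 p.2.
Hypothesis homB2 : forall p, p \in B2 -> gen_weight_space p.1 p.2.
Hypothesis genB1 : forall h x, gen_weight_space h x ->
  lin_span ([set y | (h, y) \in B1] `|` mode_generator g2 T2 h) x.
Hypothesis genB2 : forall h x, gen_weight_space h x ->
  lin_span ([set y | (h, y) \in B2] `|` mode_generator g1 T1 h) x.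
Hypothesis HB : forall p1 p2, p1 \in B1 -> p2 \in B2 ->
  H (I p1.2 p2.2 (p1.1 + p2.1 - lam - 1) 0%N).

(** Induction on the total weight. Arguments that are modes are handled by [reduce_left] and
    [reduce_right], and pairs from [B1] and [B2] by [HB]. *)
Lemma vanish_homogeneous h1 h2 w1 w2 n :
  gen_weight_space h1 w1 -> gen_weight_space h2 w2 -> H (I w1 w2 n 0%N).
Proof.
have [T10 _ _] := hT1; have [T20 _ _] := hT2.
have T1n0 : T1%:R != 0 :> R[i] by rewrite pnatr_eq0 -lt0n.
have T2n0 : T2%:R != 0 :> R[i] by rewrite pnatr_eq0 -lt0n.
have [N1 N1P] := hW1.2 h1; have [N2 N2P] := hW2.2 h2.
(* With weights [h1 + a / T1] and [h2 + b / T2], the integer [a T2 + b T1] is the total weight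
   relative to [h1 + h2] with denominators cleared. If it is at most [K], then [a <= N1] or
   [b <= N2], and one argument is zero. *)
pose K := N1 * T2%:Z + N2 * T1%:Z.
suff main (d : nat) (a b : int) w1' w2' :
    a * T2%:Z + b * T1%:Z <= K + d%:Z ->
    gen_weight_space (h1 + a%:~R / T1%:R) w1' ->
    gen_weight_space (h2 + b%:~R / T2%:R) w2' ->
    forall n, H (I w1' w2' n 0%N).
  move=> ww1 ww2; apply: (main `|K|%N 0 0); first by lia.
    by rewrite mul0r addr0.
  by rewrite mul0r addr0.
elim: d a b w1' w2' => [|d IH] a b x y ab xa yb m.
  have [aN|aN] := leP a N1.
    by rewrite (N1P a aN x xa) (int_lin0l hI); exact: subspace0.
  have [bN|bN] := leP b N2; last by exfalso; move: ab; rewrite /K; nia.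
  by rewrite (N2P b bN y yb) (int_lin0r hI); exact: subspace0.
have sHx z : subspace [set x | H (I x z m 0%N)].
  exact: (linear_preim (int_linearl hI z m 0)).
have sHy z : subspace [set y | H (I z y m 0%N)].
  exact: (linear_preim (int_linearr hI z m 0)).
apply: (lin_span_min (sHx y) _ (genB1 xa)) => {xa}x [/= xB|]; last first.
  case=> r1 r2 v n' w r1T r2T ev1 ev2 gv n0 ww /=.
  apply: (reduce_left hg1 hg2 hT1 hT2 hI sH IM Hmode r1T r2T ev1 ev2 gv n0 ww yb).
    move=> i z l zw; apply: (IH (a - i.+1%:Z * T1%:Z) b) => //; first by nia.
    move: zw; congr (gen_weight_space _ _); rewrite intrB intrM -!pmulrn; field.
    exact: T1n0.
  move=> i z l zw.
  (* The contributions of [n'] cancel in the total, which changes by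
     [r2 T1 - r1 T2 - (i + 1) T1 T2], negative because [r2 < T2]. *)
  apply: (IH (a - n' * T1%:Z - r1%:Z) (b + n' * T2%:Z + r2%:Z - i.+1%:Z * T2%:Z)).
  - by nia.
  - move: ww; congr (gen_weight_space _ _); rewrite !intrB intrM -!pmulrn; field.
    exact: T1n0.
  - move: zw; congr (gen_weight_space _ _).
    by rewrite intrB !intrD !intrM -!pmulrn; field; exact: T2n0.
have /= xa := homB1 xB.
apply: (lin_span_min (sHy x) _ (genB2 yb)) => {yb}y [/= yB|].
  (* This is the only index at which the value has weight [lam]; any other weight space lies in
     [H]. *)
  have [->|nlam] := pselect (m = h1 + a%:~R / T1%:R + (h2 + b%:~R / T2%:R) - lam - 1).
    exact: HB xB yB.
  apply: Hweight (int_weight hg1 hg2 hT1 hT2 hI _ _ xa (homB2 yB)) => /= E.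
  by apply: nlam; rewrite -E; ring.
case=> r2 r1 v n' w r2T r1T ev2 ev1 gv n0 ww /=.
apply: (reduce_right hg1 hg2 hT1 hT2 hI sH IM Hmode r1T r2T ev1 ev2 gv n0 xa ww).
  move=> i z l zw.
  apply: (IH (a + n' * T1%:Z + r1%:Z - i.+1%:Z * T1%:Z) (b - n' * T2%:Z - r2%:Z)).
  - by nia.
  - move: zw; congr (gen_weight_space _ _).
    rewrite intrB !intrD !intrM -!pmulrn; field; exact: T1n0.
  - move: ww; congr (gen_weight_space _ _); rewrite !intrB intrM -!pmulrn; field.
    exact: T2n0.
move=> i z l zw; apply: (IH a (b - i.+1%:Z * T2%:Z)) => //; first by nia.
move: zw; congr (gen_weight_space _ _); rewrite intrB intrM -!pmulrn; field.
exact: T2n0.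
Qed.

(* The L(-1)-derivative property expresses the coefficient of (log x)^(k+1)
   through coefficients of (log x)^k. *)
Lemma vanish w1 w2 n k : H (I w1 w2 n k).
Proof.
elim: k w1 w2 n => [|k IH] w1 w2 n.
  apply: (lin_span_min (linear_preim (int_linearl hI w2 n 0) sH) _
    (direct_sum_lin_span w1 hW1.1)) => {}w1 [a wa] /=.
  apply: (lin_span_min (linear_preim (int_linearr hI w1 n 0) sH) _
    (direct_sum_lin_span w2 hW2.1)) => {}w2 [b wb] /=.
  exact: vanish_homogeneous wa wb.
have := int_derivative hI w1 w2 (n + 1) k; rewrite addrK => E.
have k0 : k.+1%:R != 0 :> R[i] by rewrite pnatr_eq0.
apply: (subspaceZr sH k0).
have -> : k.+1%:R *: I w1 w2 n k.+1
    = I (twL (-1) w1) w2 (n + 1) k + (n + 1) *: I w1 w2 n k.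
  by rewrite E scaleNr addrAC addNr add0r.
by apply: subspaceD => //; exact: subspaceZ.
Qed.

End Determination.

(** * Operators with values in the terms of a composition series *)

Hypotheses (hW1 : generalized W1) (hC1 : C1_cofinite W1).
Hypotheses (hW2 : generalized W2) (hC2 : C1_cofinite W2).
Hypothesis hW3 : generalized W3.

Local Notation intertwiner := (W1 -> W2 -> R[i] -> nat -> W3).

Definition intertwiners_in (M : set W3) : set intertwiner :=
  [set I | intertwining I /\ forall w1 w2 n k, M (I w1 w2 n k)].

Lemma submodule_L (M : set W3) x : submodule M -> M x -> M (twL 0 x).
Proof. by move=> [_ MY] Mx; exact: MY. Qed.

(* Finite supports are needed here: the sum over all i of a family with
   infinite support is 0, so that delta sums are not linear in general. *)
Lemma fsum_linear (M : lmodType R[i]) (a : R[i]) (c : nat -> R[i])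
    (f1 f2 : nat -> M) :
  (exists N, forall i, (N <= i)%N -> f1 i = 0) ->
  (exists N, forall i, (N <= i)%N -> f2 i = 0) ->
  \sum_(i \in [set: nat]) c i *: (a *: f1 i + f2 i)
  = a *: (\sum_(i \in [set: nat]) c i *: f1 i)
    + \sum_(i \in [set: nat]) c i *: f2 i.
Proof.
move=> [N1 f10] [N2 f20].
have f1N i : (maxn N1 N2 <= i)%N -> f1 i = 0 by rewrite geq_max => /andP[/f10].
have f2N i : (maxn N1 N2 <= i)%N -> f2 i = 0 by rewrite geq_max => /andP[_ /f20].
rewrite !(fsum_ord (k := maxn N1 N2)) => [|i Ni|i Ni|i Ni].
- rewrite scaler_sumr -big_split; apply: eq_bigr => i _ /=.
  by rewrite scalerDr !scalerA mulrC.
- by rewrite f2N // scaler0.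
- by rewrite f1N // scaler0.
- by rewrite f1N // f2N // addr0 !scaler0.
Qed.

Lemma tw_mode_truncation (g : V -> V) (T : nat) (W : twisted_module g T) r v q
    (w : W) : (r < T)%N -> eigen_gr g T r v ->
  exists N, forall i : nat, (N <= i)%N -> twY v (q + i%:R) w = 0.
Proof.
move=> rT ev; have [[m mE]|nq] := pselect (is_integer (q + r%:R / T%:R)); last first.
  exists 0%N => i _; apply: (tw_modes_eigen (r := r)) => // -[j jE].
  by apply: nq; exists (j - i%:Z); rewrite intrB -jE -pmulrn; ring.
have [N NP] := tw_truncation w rT ev; exists `|N - m|%N => i Ni.
have -> : q + i%:R = (m + i%:Z)%:~R - r%:R / T%:R.
  by rewrite intrD -mE -pmulrn; ring.
by apply: NP; lia.
Qed.

Lemma intertwining0 : intertwining (0 : intertwiner).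
Proof.
split=> //= [w2 n k a x y|w1 n k a x y|w1 w2 n|w1 w2 h|r1 r2 v w1 w2 p q s k *|w1 w2 n k].
- by rewrite scaler0 addr0.
- by rewrite scaler0 addr0.
- by exists 0%N.
- by exists 0%N.
(* Each delta sum has all its terms in the zero subspace, so it is zero. *)
- rewrite (delta_left_sub (@subspace_set1 _ W3)) => [|i]; last exact: (lin0 (tw_linearr _ _)).
  rewrite (delta_right_sub (@subspace_set1 _ W3)) => [|//].
  by rewrite (delta_iter_sub (@subspace_set1 _ W3)) ?subr0.
- by rewrite !scaler0 addr0.
Qed.

Lemma intertwining_linear (a : R[i]) (I J : intertwiner) :
  intertwining I -> intertwining J -> intertwining (a *: I + J).
Proof.
move=> hI hJ; pose E w1 w2 n k : W3 := a *: I w1 w2 n k + J w1 w2 n k.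
rewrite (_ : a *: I + J = E) //.
split=> [w2 n k c x y|w1 n k c x y|w1 w2 n|w1 w2 h
  |r1 r2 v w1 w2 p q s k r1T r2T ev1 ev2|w1 w2 n k].
- rewrite /E (int_linearl hI) (int_linearl hJ) !scalerDr !scalerA [c * a]mulrC.
  by rewrite addrACA.
- rewrite /E (int_linearr hI) (int_linearr hJ) !scalerDr !scalerA [c * a]mulrC.
  by rewrite addrACA.
- have [K IK] := int_log hI w1 w2 n; have [L JL] := int_log hJ w1 w2 n.
  exists (maxn K L) => k; rewrite geq_max => /andP[/IK Ik /JL Jk].
  by rewrite /E Ik Jk scaler0 addr0.
- have [K IK] := int_truncation hI w1 w2 h.
  have [L JL] := int_truncation hJ w1 w2 h.
  exists (maxn K L) => n k; rewrite geq_max => /andP[/IK Ik /JL Jk].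
  by rewrite /E Ik Jk scaler0 addr0.
(* Each of the three delta sums has finite support by its own truncation condition, as [fsum_linear]
   demands. *)
- have truncl (G : intertwiner) : intertwining G -> forall q', exists N, forall i,
      (N <= i)%N -> twY v (q' - i%:R) (G w1 w2 (s + i%:R) k) = 0.
    move=> hG q'; have [N NP] := int_truncation hG w1 w2 s; exists N => i Ni.
    by rewrite NP // (lin0 (tw_linearr _ _)).
  have truncr (G : intertwiner) : intertwining G -> exists N, forall i,
      (N <= i)%N -> G w1 (twY v (q + i%:R) w2) (p + s - i%:R) k = 0.
    move=> hG; have [N NP] := tw_mode_truncation q w2 r2T ev2; exists N => i Ni.
    by rewrite NP // (int_lin0r hG).
  have trunci (G : intertwiner) : intertwining G -> exists N, forall i,
      (N <= i)%N -> G (twY v (p + i%:R) w1) w2 (q + s - i%:R) k = 0.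
    move=> hG; have [N NP] := tw_mode_truncation p w1 r1T ev1; exists N => i Ni.
    by rewrite NP // (int_lin0l hG).
  have JI := int_jacobi hI w1 w2 p q s k r1T r2T ev1 ev2.
  have JJ := int_jacobi hJ w1 w2 p q s k r1T r2T ev1 ev2.
  transitivity (a *: delta_iter (- (r2%:R / T2%:R))
      (fun m n => I (twY v m w1) w2 n k) p q s
    + delta_iter (- (r2%:R / T2%:R)) (fun m n => J (twY v m w1) w2 n k) p q s);
    last first.
    rewrite /delta_iter; case: asboolP => _; last by rewrite scaler0 addr0.
    by rewrite fsum_linear //; exact: trunci.
  rewrite -JI -JJ scalerBr addrACA -opprD; congr (_ - _).
    rewrite /delta_left; case: asboolP => _; last by rewrite scaler0 addr0.
    rewrite -fsum_linear //; try exact: truncl.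
    by apply: eq_fsbigr => i _; rewrite /E (tw_linearr v).
  rewrite /delta_right; case: asboolP => _; last by rewrite scaler0 addr0.
  by rewrite fsum_linear //; exact: truncr.
- rewrite /E (int_derivative hI) (int_derivative hJ) !scalerDr !scalerA.
  by rewrite [- n * a]mulrC [_ * a]mulrC addrACA.
Qed.

Lemma intertwiners_in_subspace M : subspace M -> subspace (intertwiners_in M).
Proof.
move=> sM; split.
  by split=> [|w1 w2 n k]; [exact: intertwining0 | exact: subspace0].
move=> a I J [hI MI] [hJ MJ]; split; first exact: intertwining_linear.
by move=> w1 w2 n k; apply: subspaceD => //; exact: subspaceZ.
Qed.

Lemma submodule_add (M N : set W3) : submodule M -> submodule N ->
  submodule [set x | exists u v, [/\ M u, N v & x = u + v]].
Proof.
move=> [sM MY] [sN NY]; split; first exact: subspace_add.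
move=> v n _ [u [u' [Mu Nu' ->]]]; exists (twY v n u), (twY v n u').
by split; [exact: MY | exact: NY | rewrite (linD (tw_linearr v n))].
Qed.

(** [N] contains the weight components of its elements, so some weight vector lies in [N] outside
    [M]. The weights of such vectors in one coset of [Z / T3] are bounded below, and a minimal one
    is chosen. *)
Lemma exists_lowest_weight_vector (M N : set W3) :
  submodule M -> submodule N -> M `<=` N -> M <> N ->
  exists lam u, [/\ N u, gen_weight_space lam u, ~ M u
    & forall (n : int) y, 0 < n -> N y ->
        gen_weight_space (lam - n%:~R / T3%:R) y -> M y].
Proof.
move=> sM sN MN MneN.
have [x [Nx Mx]] : exists x, N x /\ ~ M x.
  apply: contrapT => /forallNP NM; apply: MneN; apply/seteqP; split=> // x Nx.
  by apply: contrapT => Mx; exact: (NM x).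
have [s [f [us Wf xE]]] := direct_sum_uniq x hW3.1.
have lL : linear (twL (W := W3) 0) by exact: tw_L0_linear.
have LN y : N y -> N (twL 0 y) by exact: submodule_L.
have Nf := components_in_subspace lL (proj1 sN) LN us Wf.
rewrite -xE in Nf; have {}Nf a := Nf Nx a.
have [a [Nfa Mfa]] : exists a, N (f a) /\ ~ M (f a).
  apply: contrapT => /forallNP NM; apply: Mx; rewrite xE.
  apply: (subspace_sum (proj1 sM)) => a a_s _; have Nfa := Nf a a_s.
  by apply: contrapT => Mfa; exact: (NM a).
have M0 := subspace0 (proj1 sM).
have [K KP] := hW3.2 a.
(* Counting from the lower bound [K] turns the choice of a minimal weight into a minimum over
   natural numbers. *)
pose P (j : nat) := `[< exists u, [/\ N u,
  gen_weight_space (a + (K + j%:Z)%:~R / T3%:R) u & ~ M u] >].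
have K0 : K < 0.
  rewrite ltNge; apply/negP => K0; apply: Mfa.
  by rewrite (KP 0 K0 (f a)) // mul0r addr0; exact: Wf.
have [j /asboolP[u [Nu Wu Mu]] jmin] : exists2 j, P j & forall i, P i -> (j <= i)%N.
  have exP : exists j, P j.
    exists `|K|%N; apply/asboolP; exists (f a); split=> //.
    by rewrite (_ : K + `|K|%N%:Z = 0) ?mul0r ?addr0; [exact: Wf | lia].
  by have [j Pj jmin] := ex_minnP exP; exists j.
exists (a + (K + j%:Z)%:~R / T3%:R), u; split=> // n y n0 Ny Wy.
have {}Wy : gen_weight_space (a + (K + j%:Z - n)%:~R / T3%:R) y.
  by move: Wy; congr (gen_weight_space _ _); rewrite intrB; ring.
have [le|lt] := leP (K + j%:Z - n) K; first by rewrite (KP _ le _ Wy).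
apply: contrapT => My; have : (j <= `|j%:Z - n|)%N.
  apply: jmin; apply/asboolP; exists y; split=> //.
  by move: Wy; congr (gen_weight_space (_ + _%:~R / _) _); lia.
by lia.
Qed.

(** Among the operators with values in [N], those with values in [M] are cut out by one hyperplane
    condition for each pair in the product of [B1] and [B2]. *)
Lemma finspan_intertwiners_step (M N : set W3) :
  submodule M -> submodule N -> M `<=` N -> M <> N ->
  (forall U, submodule U -> M `<=` U -> U `<=` N -> U = M \/ U = N) ->
  finspan (intertwiners_in M) -> finspan (intertwiners_in N).
Proof.
move=> sM sN MN MneN simple fM.
have [lam [u [Nu Wu Mu lowest]]] := exists_lowest_weight_vector sM sN MN MneN.
have [T30 _ _] := hT3; have hg3 := aut_comp hg1 hg2.
have T3n0 : T3%:R != 0 :> R[i] by rewrite pnatr_eq0 -lt0n.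
pose Wother := [set y : W3 | exists2 b, b != lam & gen_weight_space b y].
(* If [u] were in [K], then modulo [M] it would be a sum of vectors of weights other than [lam],
   which forces [u] into [M]. *)
pose K := [set x | exists m z, [/\ M m, lin_span Wother z & x = m + z]].
have sK : subspace K.
  by apply: subspace_add; [exact: (proj1 sM) | exact: lin_span_subspace].
have Ku : ~ K u.
  move=> [m [_ [Mm [n [c [y [Wy ->]]]] uE]]]; apply: Mu.
  apply: (component_in_subspace (@tw_L0_linear _ _ _ _ W3) (proj1 sM) _ Wu
    (s := [seq c i *: y i | i <- enum 'I_n])).
  - by move=> x; exact: submodule_L.
  - move=> _ /mapP[i _ ->]; have [b blam Wb] := Wy i; exists b => //.
    by apply: subspaceZ => //; exact: gen_weight_subspace.
  - by rewrite big_map big_enum /= uE addrK.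
have [H [sH KH Hu hyp]] := exists_hyperplane sK Ku.
have MH x : M x -> H x.
  move=> Mx; apply: KH; exists x, 0; rewrite addr0; split=> //.
  exact: (subspace0 (lin_span_subspace _)).
have Hweight a : a <> lam -> gen_weight_space a `<=` H.
  move=> /eqP alam x Wx; apply: KH; exists 0, x; rewrite add0r; split=> //.
    exact: (subspace0 (proj1 sM)).
  by apply: lin_span_subset; exists a.
(* Either the image has a weight other than [lam], or [x] has weight [lam] minus a positive multiple
   of [1 / T3] and lies in [M] by minimality of [lam]. *)
have Hmode v (n : int) m a x : voa_gr n v -> N x -> gen_weight_space a x ->
    0 < n%:~R - m - 1 -> H (twY v m x).
  move=> gv Nx Wx pos; have [alam|alam] := eqVneq (a + n%:~R - m - 1) lam; last first.
    apply: (Hweight _ _ _ (tw_mode_weight hg3 hT3 m gv Wx)); exact/eqP.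
  have [[j jE]|nm] := pselect (is_integer (T3%:R * m)); last first.
    by rewrite tw_modes //; exact: subspace0.
  apply: MH; apply: (proj2 sM).
  have nE : n%:~R - m - 1 = ((n - 1) * T3%:Z - j)%:~R / T3%:R.
    by rewrite intrB intrM intrB -jE -pmulrn; field.
  apply: (lowest ((n - 1) * T3%:Z - j)) => //.
    by move: pos; rewrite nE pmulr_lgt0 ?ltr0z // invr_gt0 ltr0n.
  by move: Wx; congr (gen_weight_space _ _); rewrite -nE -alam; ring.
have [B1 [homB1 genB1]] := homogeneous_generation hg1 hg2 hT1 hT2 gC hW1 hC1.
have [B2 [homB2 genB2]] :=
  homogeneous_generation hg2 hg1 hT2 hT1 (fun v => esym (gC v)) hW2 hC2.
pose phi (j : (R[i] * W1) * (R[i] * W2)) (I : intertwiner) : W3 :=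
  I j.1.2 j.2.2 (j.1.1 + j.2.1 - lam - 1) 0%N.
have sSN := intertwiners_in_subspace (proj1 sN).
apply: (finspan_hyperplanes (phi := phi)
  (s := [seq (p1, p2) | p1 <- B1, p2 <- B2]) sSN sH hyp) => //.
rewrite (_ : mkset _ = intertwiners_in M) //; apply/seteqP; split=> I /=.
  move=> [[hI NI] HI]; split=> // w1 w2 n k.
  have HI' : forall w1 w2 n k, H (I w1 w2 n k).
    apply: (vanish hI sH NI Hweight Hmode hW1 hW2 homB1 homB2 genB1 genB2).
    by move=> p1 p2 p1B p2B; apply: (HI (p1, p2)); exact: allpairs_f.
  have sI := int_image_submodule hg1 hg2 gC hT1 hT2 hI.
  (* [M] plus the image of [I] lies between [M] and [N]. It is contained in [H], which misses [u],
     so it cannot be [N]. *)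
  have [||UM|UN] := simple _ (submodule_add sM sI).
  - move=> x Mx; exists x, 0; rewrite addr0; split=> //.
    exact: (subspace0 (proj1 sI)).
  - move=> _ [x [y [/MN Nx Iy ->]]]; apply: (subspaceD (proj1 sN)) => //.
    by apply: (lin_span_min (proj1 sN) _ Iy) => _ [? [? [? [? ->]]]].
  - rewrite -UM; exists 0, (I w1 w2 n k); rewrite add0r; split=> //.
      exact: (subspace0 (proj1 sM)).
    exact: int_image_mem.
  - exfalso; apply: Hu; move: Nu; rewrite -UN => -[x [y [/MH Hx Iy ->]]].
    apply: subspaceD => //.
    by apply: (lin_span_min sH _ Iy) => _ [? [? [? [? ->]]]].
move=> [hI MI]; split; first by split=> // *; exact: MN.
by move=> j _; apply: MH; exact: MI.
Qed.

End Finiteness.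

Theorem theorem4p3 (R : realType) (V : voa R) (g1 g2 : V -> V)
    (T1 T2 T3 : nat)
    (hg1 : voa_automorphism g1) (hg2 : voa_automorphism g2)
    (hcomm : forall v : V, g1 (g2 v) = g2 (g1 v))
    (hT1 : has_order g1 T1) (hT2 : has_order g2 T2)
    (hT3 : has_order (fun v : V => g1 (g2 v)) T3)
    (W1 : twisted_module g1 T1) (W2 : twisted_module g2 T2)
    (W3 : twisted_module (fun v : V => g1 (g2 v)) T3)
    (hW1 : generalized W1) (hC1 : C1_cofinite W1)
    (hW2 : generalized W2) (hC2 : C1_cofinite W2)
    (hW3 : generalized W3) (hl3 : finite_length W3) :
  exists N : nat, fusion_rule W1 W2 W3 N.
Proof.
have [l [M [M0 Ml subM stepM]]] := hl3.
have fin i : (i <= l)%N -> finspan (intertwiners_in (W1 := W1) (W2 := W2) (M i)).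
  elim: i => [_|i IH il].
    (* At the bottom of the series only the zero operator remains, spanned by the empty family. *)
    exists 0%N, (fun=> 0); split=> [[]//|I [_ I0]]; exists (fun=> 0).
    rewrite big_ord0; do 4!apply/funext => ?; have := I0; rewrite M0; exact.
  have [Msub Mne simple] := stepM i il.
  apply: (finspan_intertwiners_step hg1 hg2 hcomm hT1 hT2 hT3 hW1 hC1 hW2 hC2 hW3
    (M := M i)) => //; [exact/subM/ltnW | exact: subM | exact/IH/ltnW].
have inM : intertwiners_in (M l) = [set I : W1 -> W2 -> R[i] -> nat -> W3 | intertwining I].
  by rewrite Ml; apply/seteqP; split=> I //= [].
have sub : subspace (intertwiners_in (W1 := W1) (W2 := W2) (M l)).
  by apply: intertwiners_in_subspace; have [] := subM l (leqnn l).
have [N] := finspan_dim sub (fin l (leqnn l)).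
by rewrite inM => hN; exists N.
Qed.
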